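(* Let $\mathcal{L}\subseteq\mathbb{R}^3$ be a subspace and $\mathbf{a}\in\mathbb{R}^3$ such that $(\mathcal{L}+\mathbf{a})\cap K_{\exp}\ne\emptyset$. Then the following hold. 1. The distance to the PPS condition of $\{K_{\exp},\mathcal{L}+\mathbf{a}\}$ satisfies $d_{\mathrm{PPS}}(K_{\exp},\mathcal{L}+\mathbf{a})\le1$. 2. If $d_{\mathrm{PPS}}(K_{\exp},\mathcal{L}+\mathbf{a})=0$, then $K_{\exp}$ and $\mathcal{L}+\mathbf{a}$ satisfy a Lipschitzian error bound. 3. Suppose $d_{\mathrm{PPS}}(K_{\exp},\mathcal{L}+\mathbf{a})=1$ and let $\mathcal{F}\subsetneq K_{\exp}$ be a chain of faces of length $2$ such that $\mathcal{F}=K_{\exp}\cap\{\mathbf{z}\}^\perp$ for some $\mathbf{z}\in K_{\exp}^*\cap\mathcal{L}^\perp\cap\{\mathbf{a}\}^\perp$, $\mathcal{F}\cap(\mathcal{L}+\mathbf{a})=K_{\exp}\cap(\mathcal{L}+\mathbf{a})$, and $\{\mathcal{F},\mathcal{L}+\mathbf{a}\}$ satisfies the PPS condition. Then: (a) If $\mathcal{F}=\mathcal{F}_{-\infty}$, then $K_{\exp}$ and $\mathcal{L}+\mathbf{a}$ satisfy an entropic error bound: for every bounded set $B$ there exists $\kappa_B>0$ such that $$\mathrm{d}(\mathbf{x},(\mathcal{L}+\mathbf{a})\cap K_{\exp})\le\kappa_B\,\mathfrak{g}_{-\infty}\big(\max\{\mathrm{d}(\mathbf{x},\mathcal{L}+\mathbf{a}),\mathrm{d}(\mathbf{x},K_{\exp})\}\big)\quad\forall\,\mathbf{x}\in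 B.$$ In addition, for all $\alpha\in(0,1)$, a uniform Hölderian error bound with exponent $\alpha$ holds. (b) If $\mathcal{F}=\mathcal{F}_\beta$ with $\beta\in\mathbb{R}$, then $K_{\exp}$ and $\mathcal{L}+\mathbf{a}$ satisfy a uniform Hölderian error bound with exponent $1/2$. (c) Suppose that $\mathcal{F}=\mathcal{F}_\infty$. If there exists $\mathbf{z}\in K_{\exp}^*\cap\mathcal{L}^\perp\cap\{\mathbf{a}\}^\perp$ with $z_x=0$, $z_y>0$ and $z_z>0$, then $K_{\exp}$ and $\mathcal{L}+\mathbf{a}$ satisfy a Lipschitzian error bound. Otherwise, they satisfy a log-type error bound: for every bounded set $B$ there exists $\kappa_B>0$ such that $$\mathrm{d}(\mathbf{x},(\mathcal{L}+\mathbf{a})\cap K_{\exp})\le\kappa_B\,\mathfrak{g}_{\infty}\big(\max\{\mathrm{d}(\mathbf{x},\mathcal{L}+\mathbf{a}),\mathrm{d}(\mathbf{x},K_{\exp})\}\big)\quad\forall\,\mathbf{x}\in B.$$ (d) If $\mathcal{F}=\{\mathbf{0}\}$, then $K_{\exp}$ and $\mathcal{L}+\mathbf{a}$ satisfy a Lipschitzian error bound.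
   Context: $\mathbb{R}^3$ carries the standard inner product and Euclidean norm; vectors are written $\mathbf{p}=(p_x,p_y,p_z)$; $\mathrm{d}(\mathbf{x},C)=\inf_{\mathbf{y}\in C}\|\mathbf{x}-\mathbf{y}\|$; $\mathrm{ri}$ denotes relative interior. The exponential cone is $K_{\exp}=\{(x,y,z):y>0,\ z\ge ye^{x/y}\}\cup\{(x,y,z):x\le0,\ z\ge0,\ y=0\}$ and $K_{\exp}^*$ is its dual cone. The following faces of $K_{\exp}$ are used: $\mathcal{F}_{-\infty}=\{(x,y,z):x\le0,z\ge0,y=0\}$; $\mathcal{F}_\beta=\{(-\beta y+y,y,e^{1-\beta}y):y\ge0\}$ for $\beta\in\mathbb{R}$; $\mathcal{F}_\infty=\{(x,0,0):x\le0\}$. $\mathfrak{g}_{-\infty},\mathfrak{g}_\infty:[0,\infty)\to[0,\infty)$: $\mathfrak{g}_{-\infty}(0)=0$, $\mathfrak{g}_{-\infty}(t)=-t\ln t$ for $0<t\le1/e^2$, $\mathfrak{g}_{-\infty}(t)=t+1/e^2$ for $t>1/e^2$; $\mathfrak{g}_\infty(0)=0$, $\mathfrak{g}_\infty(t)=-1/\ln t$ for $0<t\le1/e^2$, $\mathfrak{g}_\infty(t)=\frac14+\frac14e^2t$ for $t>1/e^2$. Error bounds: $C_1,C_2$ (convex sets with nonempty intersection) satisfy a uniform Hölderian error bound with exponent $\gamma\in(0,1]$ if for every bounded set $B$ there is $\kappa_B>0$ with $\mathrm{d}(\mathbf{x},C_1\cap C_2)\le\kappa_B\max\{\mathrm{d}(\mathbf{x},C_1),\mathrm{d}(\mathbf{x},C_2)\}^\gamma$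 for all $\mathbf{x}\in B$; a Lipschitzian error bound is the case $\gamma=1$. A face of a closed convex cone $\mathcal{K}$ is a closed convex cone $\mathcal{F}\subseteq\mathcal{K}$ such that $\mathbf{x},\mathbf{y}\in\mathcal{K}$, $\mathbf{x}+\mathbf{y}\in\mathcal{F}$ imply $\mathbf{x},\mathbf{y}\in\mathcal{F}$. A chain of faces of $\mathcal{K}$ of length $\ell$ is a sequence $\mathcal{F}_\ell\subsetneq\cdots\subsetneq\mathcal{F}_1$ of faces of $\mathcal{K}$. PPS (partial polyhedral Slater's) condition: for a closed convex cone $\mathcal{C}$ and an affine space $\mathcal{L}+\mathbf{a}$, $\{\mathcal{C},\mathcal{L}+\mathbf{a}\}$ satisfies the PPS condition if one of the following holds: 1) $(\mathcal{L}+\mathbf{a})\cap\mathrm{ri}\,\mathcal{C}\ne\emptyset$; 2) $(\mathcal{L}+\mathbf{a})\cap\mathcal{C}\ne\emptyset$ and $\mathcal{C}$ is polyhedral; 3) $\mathcal{C}$ can be written as a direct product $\mathcal{C}^1\times\mathcal{C}^2$ of cones in real Euclidean spaces with $\mathcal{C}^1$ polyhedral and $(\mathcal{L}+\mathbf{a})\cap(\mathcal{C}^1\times\mathrm{ri}\,\mathcal{C}^2)\ne\emptyset$. The distance to the PPS condition $d_{\mathrm{PPS}}(\mathcal{K},\mathcal{L}+\mathbf{a})$ is the length minus one of the shortest chain of faces $\mathcal{F}_\ell\subsetneq\cdots\subsetneq\mathcal{F}_1=\mathcal{K}$ such that $\mathcal{F}_\ell\cap(\mathcal{L}+\mathbf{a})=\mathcal{K}\cap(\mathcal{L}+\mathbf{a})$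 and $\{\mathcal{F}_\ell,\mathcal{L}+\mathbf{a}\}$ satisfies the PPS condition. *)

(* Defs.v *)
From HB Require Import structures.
From mathcomp Require Import all_boot all_order all_algebra.
From mathcomp Require Import all_classical all_reals all_analysis.

Set Implicit Arguments.
Unset Strict Implicit.
Unset Printing Implicit Defensive.

Import Order.TTheory GRing.Theory Num.Theory.
Import numFieldNormedType.Exports.

Local Open Scope classical_set_scope.
Local Open Scope ring_scope.

Section Euclidean.
Context {R : realType}.

Definition dot n (u v : 'rV[R]_n) : R := (u *m v^T) 0 0.

(* The norm `|u| of the library is the sup norm on row vectors; it induces the
   same closed sets and the same bounded sets as the Euclidean norm, so the
   library's [closed] and [bounded_set] are used below. *)
Definition enorm n (u : 'rV[R]_n) : R := Num.sqrt (dot u u).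

(* Total; only meaningful for nonempty C (the infimum of the empty set is 0). *)
Definition dist n (x : 'rV[R]_n) (C : set 'rV[R]_n) : R :=
  inf [set enorm (x - y) | y in C].

Definition perp n (A : set 'rV[R]_n) : set 'rV[R]_n :=
  [set z | forall u, A u -> dot u z = 0].

Definition dual_cone n (C : set 'rV[R]_n) : set 'rV[R]_n :=
  [set z | forall x, C x -> 0 <= dot x z].

Definition affine_space n (L : {vspace 'rV[R]_n}) (a : 'rV[R]_n) :
    set 'rV[R]_n :=
  [set v + a | v in [set` L]].

Definition affine_set n (A : set 'rV[R]_n) : Prop :=
  forall (x y : 'rV[R]_n) (t : R), A x -> A y -> A ((1 - t) *: x + t *: y).

Definition affine_hull n (C : set 'rV[R]_n) : set 'rV[R]_n :=
  smallest (@affine_set n) C.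

Definition ri n (C : set 'rV[R]_n) : set 'rV[R]_n :=
  [set x | C x /\ exists2 e : R, 0 < e &
     [set y | affine_hull C y /\ enorm (y - x) < e] `<=` C].

Definition closed_convex_cone n (C : set 'rV[R]_n) : Prop :=
  [/\ C !=set0, closed C, convex_set C &
      forall (t : R) (x : 'rV[R]_n), 0 <= t -> C x -> C (t *: x)].

Definition polyhedral n (C : set 'rV[R]_n) : Prop :=
  exists (m : nat) (A : 'M[R]_(n, m)) (b : 'rV[R]_m),
    C = [set x | forall i, (x *m A) 0 i <= b 0 i].

Definition face n (K F : set 'rV[R]_n) : Prop :=
  [/\ closed_convex_cone F, F `<=` K &
      forall x y, K x -> K y -> F (x + y) -> F x /\ F y].

(* A chain is listed from its largest face down; its length is its size. *)
Definition face_chain n (K : set 'rV[R]_n) (Fs : seq (set 'rV[R]_n)) : Prop :=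
  (forall i, (i < size Fs)%N -> face K (nth set0 Fs i)) /\
  (forall i, (i.+1 < size Fs)%N -> nth set0 Fs i.+1 `<` nth set0 Fs i).

(* "C is the direct product C1 x C2" is read up to the linear isometry
   (u, v) |-> row_mx u v *m Q from R^n1 x R^n2 onto R^n. *)
Definition pps n (C : set 'rV[R]_n) (L : {vspace 'rV[R]_n}) (a : 'rV[R]_n) :
    Prop :=
  [\/ affine_space L a `&` ri C !=set0,
      affine_space L a `&` C !=set0 /\ polyhedral C |
      exists (n1 n2 : nat) (Q : 'M[R]_(n1 + n2, n))
             (C1 : set 'rV[R]_n1) (C2 : set 'rV[R]_n2),
        [/\ Q *m Q^T = 1%:M /\ Q^T *m Q = 1%:M,
            closed_convex_cone C1 /\ closed_convex_cone C2,
            C = [set row_mx u v *m Q | u in C1 & v in C2],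
            polyhedral C1 &
            affine_space L a `&` [set row_mx u v *m Q | u in C1 & v in ri C2]
              !=set0]].

(* For the chain K :: Fs, the length minus one is [size Fs] and the smallest
   face is [last K Fs]. The value is +oo when there is no admissible chain. *)
Definition d_pps n (K : set 'rV[R]_n) (L : {vspace 'rV[R]_n}) (a : 'rV[R]_n) :
    \bar R :=
  ereal_inf [set ((size Fs)%:R)%:E | Fs in
    [set Fs : seq (set 'rV[R]_n) |
      [/\ face_chain K (K :: Fs),
          last K Fs `&` affine_space L a = K `&` affine_space L a &
          pps (last K Fs) L a]]].

Definition error_bound n (g : R -> R) (C1 C2 : set 'rV[R]_n) : Prop :=
  forall B : set 'rV[R]_n, bounded_set B ->
    exists2 kappa : R, 0 < kappa &
      forall x, B x ->
        dist x (C1 `&` C2) <= kappa * g (Num.max (dist x C1) (dist x C2)).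

Definition holderian_error_bound n (gamma : R) (C1 C2 : set 'rV[R]_n) : Prop :=
  error_bound (fun t => t `^ gamma) C1 C2.

Definition lipschitzian_error_bound n (C1 C2 : set 'rV[R]_n) : Prop :=
  holderian_error_bound 1 C1 C2.

End Euclidean.

Section ExponentialCone.
Context {R : realType}.

Definition coordx (p : 'rV[R]_3) : R := p 0 0.
Definition coordy (p : 'rV[R]_3) : R := p 0 1.
Definition coordz (p : 'rV[R]_3) : R := p 0 2%R.

Definition vec3 (x y z : R) : 'rV[R]_3 := \row_(i < 3) [:: x; y; z]`_i.

Definition Kexp : set 'rV[R]_3 :=
  [set p | 0 < coordy p /\
           coordy p * expR (coordx p / coordy p) <= coordz p] `|`
  [set p | [/\ coordx p <= 0, 0 <= coordz p & coordy p = 0]].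

Definition F_minfty : set 'rV[R]_3 :=
  [set p | [/\ coordx p <= 0, 0 <= coordz p & coordy p = 0]].

Definition F_beta (beta : R) : set 'rV[R]_3 :=
  [set vec3 (- beta * y + y) y (expR (1 - beta) * y) | y in [set y | 0 <= y]].

Definition F_infty : set 'rV[R]_3 :=
  [set vec3 x 0 0 | x in [set x | x <= 0]].

(* Only the values at t >= 0 matter. *)
Definition g_minfty (t : R) : R :=
  if t == 0 then 0
  else if t <= (expR 1 ^+ 2)^-1 then - t * ln t
  else t + (expR 1 ^+ 2)^-1.

Definition g_infty (t : R) : R :=
  if t == 0 then 0
  else if t <= (expR 1 ^+ 2)^-1 then - (ln t)^-1
  else 4^-1 + 4^-1 * expR 1 ^+ 2 * t.

End ExponentialCone.

(* Main.v *)
(** The exponential cone [K] is the intersection of the half-spaces bounded by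
    its tangent planes along the rays through [(s, 1, exp s)]; each such plane
    touches [K] in exactly one ray.  If the affine space [V] contains no
    interior point of [K], then the tangent plane at a midpoint of two points of
    [V] and [K] supports [K] at both of them, so the intersection lies in one
    proper face, which is polyhedral: hence the distance to the PPS condition is
    at most one.  Conversely the PPS condition for [K] itself gives an interior
    point in [V], because the rays through [(s, 1, exp s)], being extreme, must
    all lie in the same factor of an orthogonal product decomposition, and [K]
    is not polyhedral.

    Error bounds combine two steps.  For [p] in [K] at distance [O(d)] from
    [V], with [V] contained in the plane exposing [F], the functional exposing
    [F] is [O(d)] at [p], and a one-variable estimate bounds the distance from
    [p] to [F]: by [d ln (1/d)] for [F_minfty] (from [y exp (x/y) <= z]), by
    [sqrt d] for [F_beta] (from [exp h - 1 - h >= h^2 / (4 (1 + |h|))]), by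
    [1 / ln (1/d)] for [F_infty], and by [d] for [0] (compactness).  Second,
    [F] and [V] are linearly regular, [F] being a ray or a quarter-plane. *)
Require Import Defs.
From HB Require Import structures.
From mathcomp Require Import all_boot all_order all_algebra.
From mathcomp Require Import all_classical all_reals all_analysis.
From mathcomp Require Import ring lra.

Set Implicit Arguments.
Unset Strict Implicit.
Unset Printing Implicit Defensive.

Import Order.TTheory GRing.Theory Num.Theory.
Import numFieldNormedType.Exports.

Local Open Scope classical_set_scope.
Local Open Scope ring_scope.

(** * Inner product, norms, distance to a set, intersections of half-spaces *)

Section DotAndDistance.
Context {R : realType}.
Implicit Types n : nat.

Lemma dotE n (u v : 'rV[R]_n) : dot u v = \sum_i u 0 i * v 0 i.
Proof. by rewrite /dot mxE; apply: eq_bigr => i _; rewrite mxE. Qed.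

Lemma dotC n (u v : 'rV[R]_n) : dot u v = dot v u.
Proof. by rewrite !dotE; apply: eq_bigr => i _; rewrite mulrC. Qed.

Lemma dotDl n (u v w : 'rV[R]_n) : dot (u + v) w = dot u w + dot v w.
Proof. by rewrite /dot mulmxDl mxE. Qed.

Lemma dotZl n t (u v : 'rV[R]_n) : dot (t *: u) v = t * dot u v.
Proof. by rewrite /dot -scalemxAl mxE. Qed.

Lemma dotNl n (u v : 'rV[R]_n) : dot (- u) v = - dot u v.
Proof. by rewrite -scaleN1r dotZl mulN1r. Qed.

Lemma dotBl n (u v w : 'rV[R]_n) : dot (u - v) w = dot u w - dot v w.
Proof. by rewrite dotDl dotNl. Qed.

Lemma dot0l n (v : 'rV[R]_n) : dot 0 v = 0.
Proof. by rewrite -(scale0r v) dotZl mul0r. Qed.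

Lemma dotNr n (u v : 'rV[R]_n) : dot u (- v) = - dot u v.
Proof. by rewrite dotC dotNl dotC. Qed.

Lemma dot_eq0 n (u : 'rV[R]_n) : dot u u = 0 -> u = 0.
Proof.
rewrite dotE => /eqP; rewrite psumr_eq0 => [/allP h|i _]; last first.
  by rewrite -expr2 sqr_ge0.
apply/rowP => i; rewrite mxE.
by have := h i (mem_index_enum i); rewrite mulf_eq0 orbb => /eqP.
Qed.

Lemma norm_coord_le n (u : 'rV[R]_n) i : `|u 0 i| <= `|u|.
Proof. by rewrite [leRHS]mx_normrE; apply: (le_bigmax _ _ (0, i)). Qed.

Lemma row_norm_le n (u : 'rV[R]_n) r :
  0 <= r -> (forall i, `|u 0 i| <= r) -> `|u| <= r.
Proof.
move=> r0 h; rewrite [leLHS]mx_normrE; apply: bigmax_le => // -[i j] _ /=.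
by rewrite (ord1 i).
Qed.

Lemma dot_le n (u v : 'rV[R]_n) : `|dot u v| <= n%:R * `|u| * `|v|.
Proof.
rewrite dotE (le_trans (ler_norm_sum _ _ _))//.
apply: (@le_trans _ _ (\sum_(i < n) `|u| * `|v|)).
  apply: ler_sum => i _; rewrite normrM.
  by rewrite ler_pM// norm_coord_le.
by rewrite sumr_const card_ord -mulrA mulr_natl.
Qed.

Lemma norm_le_enorm n (u : 'rV[R]_n) : `|u| <= enorm u.
Proof.
apply: row_norm_le => [|i]; first exact: sqrtr_ge0.
rewrite -sqrtr_sqr ler_wsqrtr// dotE (bigD1 i)//= -expr2 lerDl.
by rewrite sumr_ge0// => j _; rewrite -expr2 sqr_ge0.
Qed.

Lemma enorm_le n (u : 'rV[R]_n) : enorm u <= n%:R * `|u|.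
Proof.
have n0 : 0 <= n%:R * `|u| by rewrite mulr_ge0.
rewrite -[leRHS]ger0_norm// -sqrtr_sqr ler_wsqrtr//.
rewrite (le_trans (ler_norm _))// (le_trans (dot_le u u))//.
rewrite expr2 -mulrA mulrACA ler_wpM2r ?mulr_ge0//.
by case: n {u n0} => [|n]; rewrite ?mulr0// ler_peMr// ler1n.
Qed.

Lemma dist_le n (C : set 'rV[R]_n) x y : C y -> dist x C <= enorm (x - y).
Proof.
move=> Cy; apply: ge_inf; last by exists y.
by exists 0 => _ [w _ <-]; exact: sqrtr_ge0.
Qed.

Lemma dist_ge0 n (C : set 'rV[R]_n) x : C !=set0 -> 0 <= dist x C.
Proof.
move=> [c Cc]; apply: lb_le_inf; first by exists (enorm (x - c)), c.
by move=> _ [w _ <-]; exact: sqrtr_ge0.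
Qed.

Lemma dist_lt n (C : set 'rV[R]_n) x e :
  C !=set0 -> dist x C < e -> exists2 y, C y & `|x - y| < e.
Proof.
move=> [c Cc] /inf_lt[|_ [y Cy <-] ye]; first by exists (enorm (x - c)), c.
by exists y => //; exact: le_lt_trans (norm_le_enorm _) ye.
Qed.

Lemma dist_eq0 n (C : set 'rV[R]_n) x :
  closed C -> C !=set0 -> dist x C <= 0 -> C x.
Proof.
move=> cC C0 d0; apply: cC => B /nbhs_ballP[e /= e0 eB].
have [y Cy xy] := dist_lt C0 (le_lt_trans d0 e0).
by exists y; split => //; apply: eB; rewrite -ball_normE.
Qed.

Lemma dot_continuous n (z : 'rV[R]_n) : continuous (fun x => dot x z).
Proof.
move=> x; apply/(@cvgrPdist_le _ _ _ (nbhs x)) => /= e e0.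
have k0 : 0 < n%:R * `|z| + 1 by rewrite ltr_wpDl// mulr_ge0.
apply/nbhs_ballP; exists (e / (n%:R * `|z| + 1)); first by rewrite /= divr_gt0.
move=> y; rewrite -ball_normE /= => xy.
rewrite -dotBl (le_trans (dot_le _ _))// mulrAC mulrC.
apply: (@le_trans _ _ (`|x - y| * (n%:R * `|z| + 1))).
  by rewrite ler_wpM2l// lerDl.
by rewrite -ler_pdivlMr// ltW.
Qed.

(** The family [P] may be infinite: affine spaces and the exponential cone itself are obtained in
    this form. *)
Lemma halfspaces_closed n (P : 'rV[R]_n -> R -> Prop) :
  closed [set x | forall c r, P c r -> dot x c <= r].
Proof.
have -> : [set x | forall c r, P c r -> dot x c <= r] =
    \bigcap_(cr in [set cr | P cr.1 cr.2])
      ((fun x => dot x cr.1) @^-1` [set t | t <= cr.2]).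
  apply/seteqP; split => [x h [c r] /= Pcr|x h c r Pcr]; first exact: h.
  exact: (h (c, r)).
apply: closed_bigI => cr _; apply: preimage_closed; last exact: closed_le.
by move=> x _; exact: dot_continuous.
Qed.

Lemma halfspaces_cone n (P : set 'rV[R]_n) :
  closed_convex_cone [set x | forall c, P c -> dot x c <= 0].
Proof.
split.
- by exists 0 => c _ /=; rewrite dot0l.
- have := @halfspaces_closed n (fun c r => P c /\ r = 0).
  congr (closed _); apply/seteqP; split => x /= h.
    by move=> c Pc; exact: h.
  by move=> c _ [Pc ->]; exact: h.
- move=> x y t /set_mem xP /set_mem yP; apply/mem_set.
  change (forall c, P c -> dot (t%:num *: (x : 'rV[R]_n) + (1 - t%:num) *: (y : 'rV[R]_n)) c <= 0).
  move=> c Pc; rewrite dotDl !dotZl.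
  by rewrite -[leRHS]addr0 lerD// mulr_ge0_le0 ?onem_ge0 ?xP ?yP.
- move=> t x t0 h c Pc; rewrite dotZl mulr_ge0_le0//; exact: h.
Qed.

Lemma convex_setP n (C : set 'rV[R]_n) x y t :
  convex_set C -> C x -> C y -> 0 <= t -> t <= 1 -> C ((1 - t) *: x + t *: y).
Proof.
move=> cvx Cx Cy t0 t1; rewrite addrC.
exact: (set_mem (cvx y x (Itv01 t0 t1) (mem_set Cy) (mem_set Cx))).
Qed.

End DotAndDistance.

(** * Affine spaces, local error bounds and the Slater case *)

Section AffineSpaces.
Context {R : realType}.
Implicit Types n : nat.

(** Although [projv L] need not be orthogonal, [\1 - projv L] vanishes on [L], so the columns of its
    matrix lie in the orthogonal complement. Testing them and their opposites shows that
    [x - projv L x] is zero. *)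
Lemma perp_vspaceP n (L : {vspace 'rV[R]_n}) (x : 'rV[R]_n) :
  (forall z, perp [set` L] z -> dot x z <= 0) -> x \in L.
Proof.
move=> h; pose f := (\1 - projv L)%VF; pose A := lin1_mx f.
have fE y : y *m A = y - projv L y.
  by rewrite mul_rV_lin1/= !lfunE/= !lfunE.
have dotA y j : dot y (col j A)^T = (y *m A) 0 j.
  by rewrite /dot trmxK !mxE; apply: eq_bigr => i _; rewrite mxE.
have colP j : perp [set` L] (col j A)^T.
  by move=> u /= uL; rewrite dotA fE projv_id// subrr mxE.
suff : x - projv L x = 0 by move/eqP; rewrite subr_eq0 => /eqP->; exact: memv_proj.
apply/rowP => j; rewrite -fE -dotA mxE; apply/eqP; rewrite eq_le h//=.
rewrite -oppr_le0 -dotNr; apply: h => u uL.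
by rewrite dotNr colP// oppr0.
Qed.

Lemma affine_spaceE n (L : {vspace 'rV[R]_n}) a c x :
  affine_space L a c -> affine_space L a x <-> x - c \in L.
Proof.
move=> [v /= vL <-]; split => [[w /= wL <-]|h].
  by rewrite opprD addrACA subrr addr0 memvB.
exists (x - a); last by rewrite subrK.
have -> : x - a = x - (v + a) + v by rewrite opprD addrA addrAC subrK.
exact: memvD.
Qed.

Lemma affine_space_closed n (L : {vspace 'rV[R]_n}) a :
  closed (affine_space L a).
Proof.
have -> : affine_space L a = [set x | forall c r,
    perp [set` L] c /\ r = dot a c -> dot x c <= r].
  apply/seteqP; split => [_ [v vL <-] c _ [cL ->]|x h].
    by rewrite dotDl cL// add0r.
  exists (x - a); last by rewrite subrK.
  apply: perp_vspaceP => z zL.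
  by rewrite dotBl subr_le0; exact: h.
exact: halfspaces_closed.
Qed.

(* Two points within [2 d] of [x] are at most [4 d] apart: approximating [x] within
   twice its distance to each set avoids nearest points. *)
Definition local_error_bound n (g : R -> R) (C V : set 'rV[R]_n) :=
  forall M, 0 < M -> exists2 k, 0 <= k & forall p v d, C p -> V v ->
    `|p| <= M -> `|v| <= M -> 0 < d -> d <= M -> `|p - v| <= 4 * d ->
    exists w, [/\ C w, V w & `|p - w| <= k * g d].

Lemma error_bound_sym n (g : R -> R) (C V : set 'rV[R]_n) :
  error_bound g C V -> error_bound g V C.
Proof.
move=> h B /h[k k0 hk]; exists k => // x Bx.
by rewrite setIC maxC; exact: hk.
Qed.

(** For positive [d], approximants of [x] in [C] and [V] within [2 * d] exist and are at most
    [4 * d] apart; domination of [d] by [g d] absorbs the step from [x] to [p]. For [d = 0] no such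
    slack exists, and closedness puts [x] in both sets. *)
Lemma local_error_boundP n (g : R -> R) (C V : set 'rV[R]_n) :
  closed C -> closed V -> C `&` V !=set0 -> 0 <= g 0 ->
  (forall M, 0 < M -> exists2 k, 0 <= k & forall d, 0 < d -> d <= M -> d <= k * g d) ->
  local_error_bound g C V -> error_bound g C V.
Proof.
move=> cC cV CV0 g0 gM lb B [M1 [_ hM1]].
have [c [Cc Vc]] := CV0.
have C0 : C !=set0 by exists c.
have V0 : V !=set0 by exists c.
have [M M0 BM] : exists2 M, 0 < M & forall x, B x -> `|x| <= M.
  exists (`|M1| + 1); first by rewrite ltr_wpDl.
  by apply: hM1; rewrite (le_lt_trans (ler_norm _))// ltrDl.
(* [D] bounds the distance from a point of [B] to the common point [c], hence bounds [d]; then [N]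
   bounds [p], [v] and [d]. *)
pose D := n%:R * (M + `|c|) + 1.
have D0 : 0 < D by rewrite ltr_wpDl// mulr_ge0// addr_ge0// ltW.
pose N := M + 2 * D.
have N0 : 0 < N by rewrite addr_gt0// mulr_gt0.
have [k k0 hk] := lb N N0.
have [k1 k10 hk1] := gM N N0.
exists (n%:R * (2 * k1 + k) + 1).
  by rewrite ltr_wpDl// mulr_ge0// addr_ge0// mulr_ge0.
move=> x Bx; set d := Num.max _ _.
have dC : dist x C <= d by rewrite le_max lexx.
have dV : dist x V <= d by rewrite le_max lexx orbT.
have d0 : 0 <= d by rewrite (le_trans (dist_ge0 x C0)).
have dc A : A c -> dist x A <= D.
  move=> Ac; rewrite (le_trans (dist_le _ Ac))// (le_trans (enorm_le _))//.
  apply: (@le_trans _ _ (n%:R * (M + `|c|))); last by rewrite lerDl.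
  rewrite ler_wpM2l// (le_trans (ler_normB _ _))// lerD2r.
  exact: BM.
have dD : d <= D by rewrite ge_max !dc.
have [d_eq|d_neq] := eqVneq d 0.
  rewrite d_eq in dC dV *.
  have CVx : (C `&` V) x by split; exact: dist_eq0.
  rewrite (le_trans (dist_le _ CVx))// subrr.
  rewrite (le_trans (enorm_le _))// normr0 mulr0 mulr_ge0//.
  by rewrite addr_ge0// mulr_ge0// addr_ge0// mulr_ge0.
have {d_neq}d_gt0 : 0 < d by rewrite lt_neqAle eq_sym d_neq.
have d2 : d < 2 * d by lra.
have [p Cp xp] := dist_lt C0 (le_lt_trans dC d2).
have [v Vv xv] := dist_lt V0 (le_lt_trans dV d2).
have small y : `|x - y| < 2 * d -> `|y| <= N.
  move=> xy; have -> : y = x - (x - y) by rewrite subKr.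
  rewrite (le_trans (ler_normB _ _))// lerD ?BM//.
  by rewrite (le_trans (ltW xy))// ler_pM2l.
have dN : d <= N by rewrite /N; lra.
have pv : `|p - v| <= 4 * d.
  have -> : p - v = (x - v) - (x - p) by rewrite opprB [RHS]addrC subrKA.
  by rewrite (le_trans (ler_normB _ _))//; lra.
have [w [Cw Vw pw]] := hk p v d Cp Vv (small _ xp) (small _ xv) d_gt0 dN pv.
have gd := hk1 d d_gt0 dN.
have gd0 : 0 <= g d.
  rewrite leNgt; apply/negP => /ltW g_le.
  by have := lt_le_trans d_gt0 gd; rewrite ltNge mulr_ge0_le0.
rewrite (le_trans (dist_le _ (conj Cw Vw)))// (le_trans (enorm_le _))//.
apply: (@le_trans _ _ (n%:R * (2 * k1 + k) * g d)); last first.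
  by rewrite ler_wpM2r// lerDl.
rewrite -mulrA ler_wpM2l//.
have -> : x - w = (x - p) + (p - w) by rewrite subrKA.
rewrite (le_trans (ler_normD _ _))// mulrDl lerD//.
by rewrite (le_trans (ltW xp))// -mulrA ler_pM2l.
Qed.

(** Moving [v] towards the Slater point [c] by a fraction [l] of order [d] stays in the affine
    space, and reaches the cone because the ball around [c] compensates for [p - v]. *)
Lemma local_error_bound_slater n (C : set 'rV[R]_n) (L : {vspace 'rV[R]_n}) a c r :
  convex_set C -> affine_space L a c -> 0 < r ->
  (forall y, `|y - c| <= r -> C y) ->
  local_error_bound id C (affine_space L a).
Proof.
move=> cvxC Vc r0 ball M M0.
exists (4 * (1 + (M + `|c|) / r)).
  by rewrite mulr_ge0// addr_ge0// divr_ge0 ?addr_ge0// ltW.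
move=> p v d Cp Vv pM vM d0 dM pv.
have s0 : 0 < 4 * d + r by rewrite addr_gt0// mulr_gt0.
pose l := 4 * d / (4 * d + r).
have l0 : 0 <= l by rewrite divr_ge0// ltW// mulr_gt0.
have l1 : l <= 1 by rewrite ler_pdivrMr// mul1r; lra.
have ld : l * r <= 4 * d.
  by rewrite mulrAC ler_pdivrMr// ler_pM2l ?mulr_gt0//; lra.
exists (v + l *: (c - v)); split.
(* [y] solves [v + l *: (c - v) = (1 - l) *: p + l *: y]; the value of [l] is the one for which [y]
   stays within [r] of [c]. *)
- pose y := c + ((1 - l) / l) *: (v - p).
  have lN0 : l != 0 by rewrite mulf_neq0 ?invr_neq0 ?gt_eqF// mulr_gt0.
  have Cy : C y.
    apply: ball; rewrite addrAC subrr add0r normrZ ger0_norm; last first.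
      by rewrite divr_ge0// subr_ge0.
    have -> : (1 - l) / l = r / (4 * d).
      by rewrite /l; field; rewrite !gt_eqF// mulr_gt0.
    by rewrite mulrAC ler_pdivrMr ?mulr_gt0// ler_pM2l// distrC.
  have -> : v + l *: (c - v) = (1 - l) *: p + l *: y.
    by apply/rowP => i; rewrite /y !mxE; field.
  exact: convex_setP.
- apply/(affine_spaceE _ Vc).
  have := (affine_spaceE v Vc).1 Vv => vc.
  have -> : v + l *: (c - v) - c = (1 - l) *: (v - c).
    by rewrite scalerBl scale1r addrAC -(opprB v c) scalerN.
  exact: memvZ.
- have -> : p - (v + l *: (c - v)) = (p - v) - l *: (c - v).
    by rewrite opprD addrA.
  rewrite (le_trans (ler_normB _ _))// normrZ (ger0_norm l0).
  rewrite mulrDr.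
  rewrite mulrDl lerD//; first by rewrite mulr1.
  have -> : 4 * ((M + `|c|) / r) * d = 4 * d * ((M + `|c|) / r) by ring.
  apply: (@le_trans _ _ (l * r * ((M + `|c|) / r))).
    rewrite -mulrA ler_wpM2l// [r * _]mulrC divfK ?gt_eqF// [leRHS]addrC.
    by rewrite (le_trans (ler_normB _ _))// lerD2l.
  by rewrite ler_wpM2r// divr_ge0 ?addr_ge0// ltW.
Qed.

End AffineSpaces.

(** * Coordinates in three-dimensional space *)

Section Space3.
Context {R : realType}.
Implicit Types u v : 'rV[R]_3.

Lemma ord3P (P : 'I_3 -> Prop) : P 0 -> P 1 -> P 2 -> forall i, P i.
Proof.
move=> P0 P1 P2 [[|[|[|//]]] i3].
- by rewrite (_ : Ordinal i3 = 0)//; exact: val_inj.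
- by rewrite (_ : Ordinal i3 = 1)//; exact: val_inj.
- by rewrite (_ : Ordinal i3 = 2)//; exact: val_inj.
Qed.

Lemma vec3x x y z : coordx (@vec3 R x y z) = x.
Proof. by rewrite /coordx mxE. Qed.

Lemma vec3y x y z : coordy (@vec3 R x y z) = y.
Proof. by rewrite /coordy mxE. Qed.

Lemma vec3z x y z : coordz (@vec3 R x y z) = z.
Proof. by rewrite /coordz mxE. Qed.

Definition vec3E := (vec3x, vec3y, vec3z).

Lemma coordxD u v : coordx (u + v) = coordx u + coordx v.
Proof. by rewrite /coordx mxE. Qed.

Lemma coordyD u v : coordy (u + v) = coordy u + coordy v.
Proof. by rewrite /coordy mxE. Qed.

Lemma coordzD u v : coordz (u + v) = coordz u + coordz v.
Proof. by rewrite /coordz mxE. Qed.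

Lemma coordxN u : coordx (- u) = - coordx u.
Proof. by rewrite /coordx mxE. Qed.

Lemma coordyN u : coordy (- u) = - coordy u.
Proof. by rewrite /coordy mxE. Qed.

Lemma coordzN u : coordz (- u) = - coordz u.
Proof. by rewrite /coordz mxE. Qed.

Lemma coordxZ t u : coordx (t *: u) = t * coordx u.
Proof. by rewrite /coordx mxE. Qed.

Lemma coordyZ t u : coordy (t *: u) = t * coordy u.
Proof. by rewrite /coordy mxE. Qed.

Lemma coordzZ t u : coordz (t *: u) = t * coordz u.
Proof. by rewrite /coordz mxE. Qed.

Lemma coordx0 : coordx (0 : 'rV[R]_3) = 0.
Proof. by rewrite /coordx mxE. Qed.

Lemma coordy0 : coordy (0 : 'rV[R]_3) = 0.
Proof. by rewrite /coordy mxE. Qed.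

Lemma coordz0 : coordz (0 : 'rV[R]_3) = 0.
Proof. by rewrite /coordz mxE. Qed.

Definition coordE := (coordxD, coordyD, coordzD, coordxN, coordyN, coordzN,
  coordxZ, coordyZ, coordzZ, coordx0, coordy0, coordz0, vec3x, vec3y, vec3z).

Lemma row3P u v :
  coordx u = coordx v -> coordy u = coordy v -> coordz u = coordz v -> u = v.
Proof. by move=> *; apply/rowP; apply: ord3P. Qed.

Lemma dot3 u v :
  dot u v = coordx u * coordx v + coordy u * coordy v + coordz u * coordz v.
Proof.
rewrite dotE !big_ord_recl big_ord0 addr0 addrA.
by congr (_ + _ + _); congr (_ * _); congr (_ _ _); exact: val_inj.
Qed.

Lemma normx_le u : `|coordx u| <= `|u|. Proof. exact: norm_coord_le. Qed.

Lemma normy_le u : `|coordy u| <= `|u|. Proof. exact: norm_coord_le. Qed.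

Lemma normz_le u : `|coordz u| <= `|u|. Proof. exact: norm_coord_le. Qed.

Lemma norm3_le u r :
  `|coordx u| <= r -> `|coordy u| <= r -> `|coordz u| <= r -> `|u| <= r.
Proof.
move=> ux uy uz; apply: row_norm_le; first exact: le_trans ux.
exact: ord3P.
Qed.

End Space3.

(** * The exponential cone as an intersection of tangent half-spaces *)

Section FacesOfKexp.
Context {R : realType}.
Implicit Types (p q : 'rV[R]_3) (s t : R).

Definition curve s : 'rV[R]_3 := vec3 s 1 (expR s).

(* Outward normal of the plane tangent to the cone along the ray of [curve s]. *)
Definition tangent s : 'rV[R]_3 := vec3 (expR s) ((1 - s) * expR s) (- 1).

Lemma dot_tangent p s :
  dot p (tangent s) = expR s * (coordx p + (1 - s) * coordy p) - coordz p.
Proof. by rewrite dot3 /tangent !vec3E; ring. Qed.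

(** With [k = x / y - s], division by [y] and [expR s] leaves [1 + k <= expR k]. *)
Lemma Kexp_tangent p s : Kexp p -> dot p (tangent s) <= 0.
Proof.
rewrite dot_tangent subr_le0 => -[[y0 h]|[x0 z0 ->]]; last first.
  by rewrite mulr0 addr0 (le_trans _ z0)// mulr_ge0_le0// expR_ge0.
apply: le_trans h; have -> : coordx p / coordy p = s + (coordx p / coordy p - s) by ring.
set k := coordx p / coordy p - s; have -> : coordx p = (s + k) * coordy p.
  by rewrite /k; field; rewrite gt_eqF.
have := expR_ge1Dx k; rewrite expRD; have := expR_gt0 s.
move: (expR s) (expR k) => es ek es0 ek1.
have -> : (s + k) * coordy p + (1 - s) * coordy p = coordy p * (1 + k) by ring.
by rewrite mulrCA ler_pM2l// ler_pM2l.
Qed.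

(** Since [1 + k < expR k] for nonzero [k], the tangent plane touches the cone only along its
    ray. *)
Lemma Kexp_tangent0 p s :
  Kexp p -> dot p (tangent s) = 0 -> p = coordy p *: curve s.
Proof.
move=> Kp; rewrite dot_tangent => /eqP; rewrite subr_eq0 => /eqP pz.
have e0 := expR_gt0 s.
case: Kp => [[y0 h]|[x0 z0 y0]]; last first.
  rewrite y0 mulr0 addr0 in pz.
  have z1 : coordz p = 0 by nra.
  have x1 : coordx p = 0 by nra.
  by apply: row3P; rewrite !coordE ?x1 ?y0 ?z1 mul0r.
pose k := coordx p / coordy p - s.
have xE : coordx p = (s + k) * coordy p by rewrite /k; field; rewrite gt_eqF.
have xyE : coordx p / coordy p = s + k by rewrite /k; ring.
have k0 : k = 0.
  apply/eqP/negPn/negP => /expR_gt1Dx; rewrite ltNge => /negP; apply.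
  move: h; rewrite -pz xyE xE expRD.
  have -> : (s + k) * coordy p + (1 - s) * coordy p = coordy p * (1 + k) by ring.
  by rewrite mulrCA ler_pM2l// ler_pM2l.
have {}xE : coordx p = s * coordy p by rewrite xE k0 addr0.
apply: row3P; rewrite !coordE ?mulr1//; first by rewrite xE mulrC.
by rewrite -pz xE; ring.
Qed.

Lemma Kexp_y_ge0 p : Kexp p -> 0 <= coordy p.
Proof. by case=> [[/ltW]|[_ _ ->]]. Qed.

Lemma Kexp_z_ge0 p : Kexp p -> 0 <= coordz p.
Proof.
case=> [[y0 /(le_trans _)]|[]//]; apply.
by rewrite mulr_ge0 ?expR_ge0// ltW.
Qed.

Lemma curve_Kexp s : Kexp (curve s).
Proof. by left; rewrite /= /curve !vec3E ltr01 divr1 mul1r. Qed.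

(** This form yields closedness and convexity at once. When [y > 0], the tangent at [s = x / y] is
    the defining inequality. *)
Lemma KexpE : Kexp = [set p : 'rV[R]_3 | forall c,
  [\/ c = vec3 0 (-1) 0, c = vec3 0 0 (-1) | exists s, c = tangent s] ->
  dot p c <= 0].
Proof.
apply/seteqP; split => [p Kp c [->|->|[s ->]]|p h].
- by rewrite dot3 !vec3E; have := Kexp_y_ge0 Kp; lra.
- by rewrite dot3 !vec3E; have := Kexp_z_ge0 Kp; lra.
- exact: Kexp_tangent.
have y0 : 0 <= coordy p.
  by have := h (vec3 0 (-1) 0) (Or31 _ _ erefl); rewrite dot3 !vec3E; lra.
have z0 : 0 <= coordz p.
  by have := h (vec3 0 0 (-1)) (Or32 _ _ erefl); rewrite dot3 !vec3E; lra.
have ht s : expR s * (coordx p + (1 - s) * coordy p) <= coordz p.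
  by rewrite -subr_le0 -dot_tangent; apply: h; apply: Or33; exists s.
move: y0; rewrite le_eqVlt => /predU1P[/esym y0|y0]; [right|left]; split=> //.
- rewrite leNgt; apply/negP => x0.
  (* With [y = 0 < x], this parameter makes the left side at least [(1 + z / x) * x = x + z], which
     exceeds [z]. *)
  have := ht (coordz p / coordx p); rewrite y0 mulr0 addr0 leNgt => /negP; apply.
  apply: (@lt_le_trans _ _ ((1 + coordz p / coordx p) * coordx p)).
    by rewrite mulrDl divfK ?gt_eqF//; lra.
  by rewrite ler_pM2r// expR_ge1Dx.
- have := ht (coordx p / coordy p).
  congr (_ <= _); rewrite mulrC; congr (_ * _); field.
  by rewrite gt_eqF.
Qed.

Lemma Kexp_cone : closed_convex_cone (@Kexp R).
Proof. by rewrite KexpE; exact: halfspaces_cone. Qed.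

Lemma exposed_face (z : 'rV[R]_3) (F : set 'rV[R]_3) :
  dual_cone Kexp z -> closed_convex_cone F -> F = Kexp `&` perp [set z] ->
  face Kexp F.
Proof.
move=> Kz coneF FE; split => //; first by rewrite FE => p [].
move=> p q Kp Kq; rewrite FE => -[_ /(_ z erefl)]; rewrite dotC dotDl => pq0.
by have := Kz p Kp; have := Kz q Kq; split; split => // _ ->; rewrite dotC; lra.
Qed.

End FacesOfKexp.

(** * The proper faces [F_minfty] and [F_beta], and interior points *)

Section DistanceToPPS.
Context {R : realType}.
Implicit Types (p q : 'rV[R]_3) (s t : R).

(** A finite list of normals serves twice: it gives the cone axioms and polyhedrality. *)
Definition halfspaces n (cs : seq 'rV[R]_n) : set 'rV[R]_n :=
  [set x | forall c, c \in cs -> dot x c <= 0].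

Lemma halfspacesP n (cs : seq 'rV[R]_n) x :
  halfspaces cs x <-> all (fun c => dot x c <= 0) cs.
Proof. by split=> [h|/allP//]; apply/allP. Qed.

Lemma halfspaces_polyhedral n (cs : seq 'rV[R]_n) : polyhedral (halfspaces cs).
Proof.
exists (size cs), (\matrix_(i, j) (nth 0 cs j) 0 i), 0.
have dotA x (j : 'I_(size cs)) :
    (x *m \matrix_(i, j) (nth 0 cs j) 0 i) 0 j = dot x (nth 0 cs j).
  by rewrite mxE dotE; apply: eq_bigr => i _; rewrite mxE.
apply/seteqP; split => [x h j|x h c /(nthP 0)[j js <-]].
  by rewrite dotA mxE; apply/h/mem_nth.
by have := h (Ordinal js); rewrite dotA mxE.
Qed.

Lemma F_minfty_halfspaces : @F_minfty R =
  halfspaces [:: vec3 1 0 0; vec3 0 0 (-1); vec3 0 1 0; vec3 0 (-1) 0].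
Proof.
apply/seteqP; split => p.
  by move=> [x0 z0 y0]; apply/halfspacesP; rewrite /= !dot3 !vec3E y0; lra.
move=> /halfspacesP; rewrite /= !dot3 !vec3E => /and5P[*].
by split; lra.
Qed.

Lemma F_beta_halfspaces b : F_beta b =
  halfspaces [:: vec3 1 (b - 1) 0; vec3 (- 1) (1 - b) 0;
    vec3 0 (expR (1 - b)) (-1); vec3 0 (- expR (1 - b)) 1; vec3 0 (-1) 0].
Proof.
apply/seteqP; split => p.
  move=> [y /= y0 <-]; apply/halfspacesP; rewrite /= !dot3 !vec3E.
  by apply/and5P; split; lra.
move=> /halfspacesP; rewrite /= !dot3 !vec3E => /and5P[h1 h2 h3 h4 /andP[h5 _]].
exists (coordy p); first by rewrite /=; lra.
by apply: row3P; rewrite !vec3E; lra.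
Qed.

Lemma F_betaE b p : F_beta b p <-> exists2 y, 0 <= y & p = y *: curve (1 - b).
Proof.
have yE y : vec3 (- b * y + y) y (expR (1 - b) * y) = y *: curve (1 - b).
  by apply: row3P; rewrite !coordE; ring.
by split=> [[y y0 <-]|[y y0 ->]]; exists y.
Qed.

Lemma F_minfty_face : face (@Kexp R) (@F_minfty R).
Proof.
apply: (@exposed_face _ (vec3 0 1 0)).
- by move=> p Kp; rewrite dot3 !vec3E; have := Kexp_y_ge0 Kp; lra.
- by rewrite F_minfty_halfspaces; exact: halfspaces_cone.
- apply/seteqP; split => p.
    move=> [x0 z0 y0]; split; first by right.
    by move=> _ ->; rewrite dot3 !vec3E y0; ring.
  move=> [Kp /(_ _ erefl)]; rewrite dot3 !vec3E => h.
  have y0 : coordy p = 0 by lra.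
  by case: Kp => // -[]; rewrite y0 ltxx.
Qed.

Lemma F_beta_exposed b :
  F_beta b = @Kexp R `&` perp [set - tangent (1 - b)].
Proof.
apply/seteqP; split => p.
  move=> /F_betaE[y y0 ->]; split.
    by have [_ _ _] := @Kexp_cone R; apply => //; exact: curve_Kexp.
  by move=> _ ->; rewrite dotC dotNr dot_tangent !coordE; ring.
move=> [Kp /(_ _ erefl)]; rewrite dotC dotNr => /eqP; rewrite oppr_eq0 => /eqP.
move=> /(Kexp_tangent0 Kp) pE; apply/F_betaE.
by exists (coordy p) => //; exact: Kexp_y_ge0.
Qed.

Lemma F_beta_face b : face (@Kexp R) (@F_beta R b).
Proof.
apply: (exposed_face _ _ (F_beta_exposed b)).
- by move=> p Kp; rewrite dotNr oppr_ge0; exact: Kexp_tangent.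
- by rewrite F_beta_halfspaces; exact: halfspaces_cone.
Qed.

(** Both inequalities are strict and continuous at [p], so they persist on a ball. *)
Lemma Kexp_interior p :
  0 < coordy p -> coordy p * expR (coordx p / coordy p) < coordz p ->
  exists2 r, 0 < r & forall q, `|q - p| <= r -> Kexp q.
Proof.
move=> y0 h.
have near_interior (F : set_system 'rV[R]_3) : Filter F ->
    @coordx R @ F --> coordx p -> @coordy R @ F --> coordy p ->
    @coordz R @ F --> coordz p ->
    \forall q \near F, 0 < coordy q /\
      0 < coordz q - coordy q * expR (coordx q / coordy q).
  move=> FF cx cy cz; apply: filterI; first exact: (cvgr_gt _ cy).
  apply: (@cvgr_gt _ _ _ _ _ (coordz p - coordy p * expR (coordx p / coordy p))).
    apply: cvgB => //; apply: cvgM => //.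
    apply: (@continuous_cvg _ R R F FF (fun q => coordx q / coordy q) expR).
      exact: continuous_expR.
    by apply: cvgM => //; apply: cvgV => //; rewrite gt_eqF.
  by rewrite subr_gt0.
have := near_interior (nbhs p) _ (@coord_continuous R 1 3 0 0 p)
  (@coord_continuous R 1 3 0 1 p) (@coord_continuous R 1 3 0 2 p).
move=> /(_ (nbhs_filter p))/nbhs_ballP[r /= r0 hr].
exists (r / 2) => [|q qp]; first by rewrite divr_gt0.
have [qy qf] : 0 < coordy q /\ 0 < coordz q - coordy q * expR (coordx q / coordy q).
  by apply: (hr q); rewrite -ball_normE /= distrC (le_lt_trans qp)//; lra.
by left; split => //; rewrite -subr_ge0 ltW.
Qed.

End DistanceToPPS.

(** * Upper bound on the distance to the PPS condition *)

Section DistanceToPPSAtMostOne.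
Context {R : realType}.
Implicit Types (p q : 'rV[R]_3) (s t : R).

Lemma affine_space_affine n (L : {vspace 'rV[R]_n}) a :
  affine_set (affine_space L a).
Proof.
move=> _ _ t [u /= uL <-] [v /= vL <-]; exists ((1 - t) *: u + t *: v).
  by rewrite /= memvD// memvZ.
by apply/rowP => i; rewrite !mxE; ring.
Qed.

Lemma Kexp_midpoint p q : Kexp p -> Kexp q -> Kexp ((1 - 2^-1) *: p + 2^-1 *: q).
Proof.
move=> Kp Kq; have [_ _ cvx _] := @Kexp_cone R.
by apply: convex_setP => //; rewrite ?invr_ge0// invf_le1 ?ler1n.
Qed.

(** The second hypothesis says that [V] misses the interior. Either all common points satisfy
    [y = 0], or one has [y > 0] and every other lies on its ray. *)
Lemma affine_set_face (V : set 'rV[R]_3) : affine_set V ->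
  (forall p, V p -> Kexp p -> 0 < coordy p ->
     coordz p <= coordy p * expR (coordx p / coordy p)) ->
  V `&` Kexp `<=` @F_minfty R \/ exists b, V `&` Kexp `<=` F_beta b.
Proof.
move=> affV bd.
have [?|/existsNP[p /not_implyP[[Vp Kp] Fp]]] :=
  pselect (V `&` Kexp `<=` @F_minfty R); [by left|right].
have py : 0 < coordy p by case: Kp => [[]|].
have tangent0 m : V m -> Kexp m -> 0 < coordy m ->
    dot m (tangent (coordx m / coordy m)) = 0.
  move=> Vm Km my; apply/eqP; rewrite eq_le Kexp_tangent//= dot_tangent subr_ge0.
  rewrite (le_trans (bd m Vm Km my))// mulrC le_eqVlt; apply/orP; left.
  by apply/eqP; congr (_ * _); field; rewrite gt_eqF.
(* The tangent plane at a midpoint supports the cone at both endpoints. *)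
have ray q : V q -> Kexp q ->
    exists s, p = coordy p *: curve s /\ q = coordy q *: curve s.
  move=> Vq Kq; set m := (1 - 2^-1) *: p + 2^-1 *: q.
  have Vm : V m by exact: affV.
  have my : 0 < coordy m by rewrite !coordE; have := Kexp_y_ge0 Kq; lra.
  have := tangent0 m Vm (Kexp_midpoint Kp Kq) my.
  set s := coordx m / _; rewrite /m dotDl !dotZl => h.
  have hp := Kexp_tangent s Kp; have hq := Kexp_tangent s Kq.
  by exists s; split; apply: Kexp_tangent0 => //; lra.
(* The parameter produced by [ray] depends on [q] a priori; as [coordy p] is nonzero, [p] determines
   it. *)
have [s [pE _]] := ray p Vp Kp.
have curve_inj t : coordy p *: curve t = coordy p *: curve s -> t = s.
  move=> /(congr1 (@coordx R)); rewrite !coordE.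
  by move=> /(mulfI _); apply; rewrite gt_eqF.
exists (1 - s) => q [Vq Kq]; apply/F_betaE; rewrite subKr.
have [t [pE' qE]] := ray q Vq Kq.
exists (coordy q); first exact: Kexp_y_ge0.
by rewrite {1}qE (curve_inj t) // -pE' -pE.
Qed.

Lemma d_pps_le n (K : set 'rV[R]_n) (L : {vspace 'rV[R]_n}) a Fs :
  face_chain K (K :: Fs) ->
  last K Fs `&` affine_space L a = K `&` affine_space L a ->
  pps (last K Fs) L a -> (d_pps K L a <= (size Fs)%:R%:E)%E.
Proof. by move=> *; apply: ereal_inf_lbound; exists Fs. Qed.

Lemma face_refl n (K : set 'rV[R]_n) : closed_convex_cone K -> face K K.
Proof. by move=> coneK; split. Qed.

(** For a polyhedral face the PPS condition is mere feasibility, so a single step down from [K] is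
    admissible. *)
Lemma d_pps_polyhedral_face n (K F : set 'rV[R]_n) (L : {vspace 'rV[R]_n}) a :
  closed_convex_cone K -> face K F -> F != K -> polyhedral F ->
  affine_space L a `&` K !=set0 -> affine_space L a `&` K `<=` F ->
  (d_pps K L a <= 1)%E.
Proof.
move=> coneK faceF FK polyF [x [Vx Kx]] VKF; apply: (@d_pps_le _ _ _ _ [:: F]).
- split => -[|[|//]] //= _; first exact: face_refl.
  have [_ FsubK _] := faceF; split => // KsubF.
  by move/eqP: FK; apply; apply/seteqP.
- apply/seteqP; split => y /= [y1 Vy]; split => //; last exact: VKF.
  by have [_ + _] := faceF; apply.
- by apply: Or32; split => //=; exists x; split => //; exact: VKF.
Qed.

Lemma d_pps_Kexp_le1 (L : {vspace 'rV[R]_3}) a :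
  affine_space L a `&` Kexp !=set0 -> (d_pps Kexp L a <= 1)%E.
Proof.
move=> feas.
have [[p [Vp Kp py pz]]|noint] := pselect (exists p, [/\ affine_space L a p,
    Kexp p, 0 < coordy p &
    coordy p * expR (coordx p / coordy p) < coordz p]).
  apply: (@le_trans _ _ 0%E); last by rewrite lee01.
  apply: (@d_pps_le _ _ _ _ [::]) => //.
    split=> -[|//] //= _; exact/face_refl/Kexp_cone.
  apply: Or31; exists p; split=> //; split=> //.
  have [r r0 hr] := Kexp_interior py pz.
  exists r => // q [_ qp]; apply: hr; rewrite (le_trans _ (ltW qp))//.
  exact: norm_le_enorm.
have neqK F s : ~ F (curve s) -> F != @Kexp R.
  by move=> h; apply/eqP => FE; apply: h; rewrite FE; exact: curve_Kexp.
have [||FK|[b FK]] := @affine_set_face (affine_space L a).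
- exact: affine_space_affine.
- move=> p Vp Kp py; rewrite leNgt; apply/negP => pz.
  by apply: noint; exists p.
- apply: (d_pps_polyhedral_face (F := @F_minfty R)) => //.
  + exact: Kexp_cone.
  + exact: F_minfty_face.
  + by apply: (neqK _ 0) => -[_ _]; rewrite vec3y => /eqP; rewrite oner_eq0.
  + by rewrite F_minfty_halfspaces; exact: halfspaces_polyhedral.
- apply: (d_pps_polyhedral_face (F := F_beta b)) => //.
  + exact: Kexp_cone.
  + exact: F_beta_face.
  (* The contact parameter of [F_beta b] is [1 - b]; shifting it by one gives a point of the cone
     off the ray. *)
  + apply: (neqK _ (2 - b)) => /F_betaE[y _ h].
    have := congr1 (@coordx R) h; have := congr1 (@coordy R) h.
    by rewrite !coordE; nra.
  + by rewrite F_beta_halfspaces; exact: halfspaces_polyhedral.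
Qed.

(** The values in the infimum are natural numbers, so one below 1 comes from the empty list, whose
    last face is [K] itself. *)
Lemma d_pps0 n (K : set 'rV[R]_n) (L : {vspace 'rV[R]_n}) a :
  d_pps K L a = 0%E -> pps K L a.
Proof.
move=> d0; have : (d_pps K L a < 1%E)%E by rewrite d0 lte01.
move=> /ereal_inf_lt[_ [Fs [_ _ ppsF] <-]].
by rewrite lte_fin ltrn1 ltnS leqn0 => /nilP FsE; rewrite FsE in ppsF.
Qed.

End DistanceToPPSAtMostOne.

(** * Affine hull of the exponential cone, and its failure to be polyhedral *)

Section PPSOfKexp.
Context {R : realType}.
Implicit Types (p q : 'rV[R]_3) (s t : R).

Lemma affine_setZ n (A : set 'rV[R]_n) t x :
  affine_set A -> A 0 -> A x -> A (t *: x).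
Proof. by move=> affA A0 /(affA 0 x t A0); rewrite scaler0 add0r. Qed.

Lemma affine_setD n (A : set 'rV[R]_n) x y :
  affine_set A -> A 0 -> A x -> A y -> A (x + y).
Proof.
move=> affA A0 Ax Ay; have := affine_setZ 2 affA A0 (affA x y 2^-1 Ax Ay).
by congr A; apply/rowP => i; rewrite !mxE; field.
Qed.

(** The cone contains 0 and a basis, and an affine set through 0 is a linear subspace. *)
Lemma affine_Kexp_full (A : set 'rV[R]_3) x :
  affine_set A -> Kexp `<=` A -> A x.
Proof.
move=> affA KA; pose e1 : 'rV[R]_3 := vec3 (-1) 0 0; pose e3 : 'rV[R]_3 := vec3 0 0 1.
have A0 : A 0 by apply: KA; right; rewrite /= !coordE.
have A1 : A e1 by apply: KA; right; rewrite /= !coordE lerN10.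
have A3 : A e3 by apply: KA; right; rewrite /= !coordE ler01.
have A2 : A (curve 0) by exact/KA/curve_Kexp.
have -> : x = - coordx x *: e1 + coordy x *: curve 0 + (coordz x - coordy x) *: e3.
  by apply: row3P; rewrite !coordE ?expR0; ring.
by do !apply: affine_setD => //; exact: affine_setZ.
Qed.

(** The affine hull is the whole space, so the relative interior is the interior. Dividing by 4 pays
    for the factor 3 between the sup norm and the Euclidean norm. *)
Lemma ri_Kexp p : ri Kexp p ->
  exists2 r, 0 < r & forall q, `|q - p| <= r -> Kexp q.
Proof.
move=> [Kp [e e0 he]]; exists (e / 4) => [|q qp]; first by rewrite divr_gt0.
apply: he; split; first by move=> A [affA KA]; exact: affine_Kexp_full.
rewrite (le_lt_trans (enorm_le _))// mulrC -ltr_pdivlMr//.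
by rewrite (le_lt_trans qp)// ltr_pM2l// ltf_pV2 ?posrE// ltr_nat.
Qed.

Lemma Kexp_below_curve s d : 0 < d -> ~ Kexp (curve s - vec3 0 0 d).
Proof.
move=> d0 /(Kexp_tangent s); rewrite dotBl !dot_tangent !coordE leNgt => /negP.
by apply; rewrite [ltRHS](_ : _ = d)//; ring.
Qed.

Lemma Kexp_chord s t : s != t -> exists2 d, 0 < d &
  Kexp ((1 - 2^-1) *: curve s + 2^-1 *: curve t - vec3 0 0 d).
Proof.
move=> st; pose a := expR (s / 2); pose b := expR (t / 2).
have sE : expR s = a ^+ 2 by rewrite expr2 -expRD; congr expR; field.
have tE : expR t = b ^+ 2 by rewrite expr2 -expRD; congr expR; field.
have mE : expR ((s + t) / 2) = a * b by rewrite -expRD; congr expR; field.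
exists ((a - b) ^+ 2 / 2).
  rewrite divr_gt0// exprn_even_gt0//= subr_eq0.
  by apply: contra st => /eqP/expR_inj h; apply/eqP; lra.
left; rewrite /= !coordE sE tE; split; first by lra.
have -> : (1 - 2^-1) * s + 2^-1 * t - 0 = (s + t) / 2 by field.
have -> : (1 - 2^-1) * 1 + 2^-1 * 1 - 0 = 1 :> R by field.
by rewrite divr1 mE mul1r le_eqVlt; apply/orP; left; apply/eqP; field.
Qed.

(** Lowering a point of the curve leaves the cone, so some inequality with a negative coefficient
    along [e3] is tight there. Among [m + 1] points two share such an inequality; it is then tight
    at their midpoint, which can nevertheless be lowered. *)
Lemma Kexp_not_polyhedral : ~ polyhedral (@Kexp R).
Proof.
move=> [m [A [b KE]]]; pose e3 : 'rV[R]_3 := vec3 0 0 1.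
have le_b p : Kexp p -> forall i, (p *m A) 0 i <= b 0 i by rewrite KE.
have linA u c v i : ((u - c *: v) *m A) 0 i = (u *m A) 0 i - c * (v *m A) 0 i.
  by rewrite mulmxBl -scalemxAl; move: (u *m A) (v *m A) => U V; rewrite !mxE.
have midA u v i : (((1 - 2^-1) *: u + 2^-1 *: v) *m A) 0 i =
    (1 - 2^-1) * (u *m A) 0 i + 2^-1 * (v *m A) 0 i.
  by rewrite mulmxDl -!scalemxAl; move: (u *m A) (v *m A) => U V; rewrite !mxE.
have tight s : exists i, b 0 i <= (curve s *m A) 0 i /\ (e3 *m A) 0 i < 0.
  apply: contrapT => /forallNP h.
  (* [w i] is the amount by which [curve s] can be lowered before inequality [i] fails; the minimum
     [d] respects all of them. *)
  pose w i := (b 0 i - (curve s *m A) 0 i) / - (e3 *m A) 0 i.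
  pose d := \big[Num.min/1]_(i | (e3 *m A) 0 i < 0) w i.
  have d0 : 0 < d.
    apply: lt_bigmin => // i Ai; rewrite divr_gt0 ?oppr_gt0// subr_gt0 ltNge.
    by apply/negP => bi; apply: (h i).
  apply: (@Kexp_below_curve s d d0); rewrite KE /= => i.
  have -> : vec3 0 0 d = d *: e3 by apply: row3P; rewrite !coordE; ring.
  rewrite linA.
  have Ci := le_b _ (curve_Kexp s) i.
  have [Ai|Ai] := ltP ((e3 *m A) 0 i) 0; last first.
    by rewrite lerBlDr (le_trans Ci)// lerDl mulr_ge0// ltW.
  have : d <= w i by exact: bigmin_le_cond.
  by rewrite ler_pdivlMr ?oppr_gt0//; lra.
have [f hf] := choice (fun k : 'I_m.+1 => tight (k : nat)%:R).
have [k [l [kl fkl]]] : exists k l, k != l /\ f k = f l.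
  apply: contrapT => h; have : injective f.
    by move=> k l fkl; apply/eqP; apply: contrapT => /negP kl; apply: h; exists k, l.
  by move/leq_card; rewrite !card_ord ltnn.
have [|d d0] := @Kexp_chord k%:R l%:R; first by rewrite eqr_nat.
move=> /le_b/(_ (f k)).
have -> : vec3 0 0 d = d *: e3 by apply: row3P; rewrite !coordE; ring.
rewrite linA midA.
have [hk1 hk2] := hf k; have [] := hf l; rewrite -fkl => hl1 _.
nra.
Qed.

End PPSOfKexp.

(** * Orthogonal product decompositions of the exponential cone *)

Section ProductDecomposition.
Context {R : realType}.
Implicit Types (p q : 'rV[R]_3) (s t : R).

Lemma dot_row_mx n1 n2 (u u' : 'rV[R]_n1) (v v' : 'rV[R]_n2) :
  dot (row_mx u v) (row_mx u' v') = dot u u' + dot v v'.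
Proof. by rewrite /dot tr_row_mx mul_row_col mxE. Qed.

Lemma dot_mul_orthogonal n m (Q : 'M[R]_(m, n)) (u v : 'rV[R]_m) :
  Q *m Q^T = 1%:M -> dot (u *m Q) (v *m Q) = dot u v.
Proof. by move=> QQ; rewrite /dot trmx_mul mulmxA -(mulmxA u) QQ mulmx1. Qed.

(** The parameters -1, 0 and 1 suffice: the second difference of the three equations, multiplied by
    [e], is [(e - 1) ^+ 2 * coordz p]. *)
Lemma curve_total p : (forall s, dot (curve s) p = 0) -> p = 0.
Proof.
move=> h; have := h 0; have := h 1; have := h (- 1).
rewrite !dot3 !vec3E expR0 expRN.
have e1 : 1 < expR 1 :> R by rewrite expR_gt1.
move: (expR 1) e1 => e e1 h1 h2 h3.
have ee : e * e^-1 = 1 by rewrite divff// gt_eqF//; lra.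
have hz : (e - 1) ^+ 2 * coordz p = 0.
  transitivity (e * ((-1 * coordx p + 1 * coordy p + e^-1 * coordz p) +
    (1 * coordx p + 1 * coordy p + e * coordz p) -
    2 * (0 * coordx p + 1 * coordy p + 1 * coordz p)) + (1 - e * e^-1) * coordz p).
    by ring.
  by rewrite h1 h2 h3 ee; ring.
have z0 : coordz p = 0.
  by apply/eqP; move/eqP: hz; rewrite mulf_eq0 sqrf_eq0 subr_eq0 (gt_eqF e1).
rewrite z0 !mulr0 in h1 h2 h3.
by apply: row3P; rewrite !coordE; lra.
Qed.

(** In the product clause one factor must be trivial. If the polyhedral factor carried everything,
    the cone would be polyhedral; so [C2] is the cone up to isometry and its relative interior
    supplies the ball. *)
Lemma pps_Kexp_interior (L : {vspace 'rV[R]_3}) a : pps Kexp L a ->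
  exists c, affine_space L a c /\
    exists2 r, 0 < r & forall q, `|q - c| <= r -> Kexp q.
Proof.
case=> [[c [Vc /ri_Kexp ?]]|[_ /Kexp_not_polyhedral//]|]; first by exists c.
move=> [n1 [n2 [Q [C1 [C2 [[QQ QQ'] [cone1 cone2] KE poly1]]]]]].
move=> [c [Vc [u C1u [v [C2v [e e0 he]]] cE]]].
have C10 : C1 0.
  by have [[w C1w] _ _ /(_ 0 w (lexx 0) C1w)] := cone1; rewrite scale0r.
have C20 : C2 0.
  by have [[w C2w] _ _ /(_ 0 w (lexx 0) C2w)] := cone2; rewrite scale0r.
have dot_cross (x : 'rV[R]_n1) (y : 'rV[R]_n2) :
    dot (row_mx x 0 *m Q) (row_mx 0 y *m Q) = 0.
  by rewrite dot_mul_orthogonal// dot_row_mx dot0l dotC dot0l addr0.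
have row_eq0 (x : 'rV[R]_(n1 + n2)) : x *m Q = 0 -> x = 0.
  by move=> xQ; rewrite -[x]mulmx1 -QQ mulmxA xQ mul0mx.
(* Extreme rays of the cone lie in one of the two orthogonal factors. *)
have factor s : (exists x, curve s = row_mx x 0 *m Q) \/
    (exists y, curve s = row_mx 0 y *m Q).
  have : Kexp (curve s) by exact: curve_Kexp.
  rewrite KE => -[x C1x [y C2y sE]].
  have sD : row_mx x 0 *m Q + row_mx 0 y *m Q = curve s.
    by rewrite -mulmxDl add_row_mx addr0 add0r.
  have Kx : Kexp (row_mx x 0 *m Q) by rewrite KE; exists x => //; exists 0.
  have Ky : Kexp (row_mx 0 y *m Q) by rewrite KE; exists 0 => //; exists y.
  (* The ray is a face, so both summands of [curve s] are multiples of it; being orthogonal, one of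
     them is zero. *)
  have [_ _ ] := F_beta_face (1 - s).
  move=> /(_ _ _ Kx Ky)[].
    by rewrite sD; apply/F_betaE; exists 1; rewrite ?ler01// scale1r subKr.
  move=> /F_betaE[kx _ xE] /F_betaE[ky _ yE]; rewrite subKr in xE yE.
  have := dot_cross x y; rewrite xE yE dotZl dotC dotZl => /eqP.
  rewrite !mulf_eq0 => /or3P[/eqP kx0|/eqP ky0|/eqP/dot_eq0 /(congr1 (@coordy R))].
  - by right; exists y; rewrite -sD xE kx0 scale0r add0r.
  - by left; exists x; rewrite -sD yE ky0 scale0r addr0.
  - by rewrite !coordE => /eqP; rewrite oner_eq0.
(* No point of the curve is orthogonal to [curve 0], so all of them lie in the factor of
   [curve 0]. *)
have dot_curve0 t : dot (curve 0) (curve t) != 0.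
  by rewrite dot3 !vec3E mul0r add0r expR0 !mul1r gt_eqF//.
have [[x0 x0E]|[y0 y0E]] := factor 0.
  have all1 t : exists x, curve t = row_mx x 0 *m Q.
    have [//|[y yE]] := factor t; have := dot_curve0 t.
    by rewrite x0E yE dot_cross eqxx.
  have y_eq0 (y : 'rV[R]_n2) : y = 0.
    have : row_mx 0 y *m Q = 0.
      by apply: curve_total => t; have [x ->] := all1 t; rewrite dot_cross.
    by move/row_eq0; rewrite -[RHS]row_mx0 => /eq_row_mx[].
  exfalso; apply: (@Kexp_not_polyhedral R).
  have [m [A [b C1E]]] := poly1.
  exists m, (Q^T *m col_mx A 0), b; rewrite KE.
  apply/seteqP; split => p.
    move=> [x C1x [y _ <-]] i.
    rewrite !mulmxA -(mulmxA (row_mx x y)) QQ mulmx1 mul_row_col mulmx0 addr0.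
    by move: C1x; rewrite C1E; exact.
  move=> /= h; exists (lsubmx (p *m Q^T)).
    rewrite C1E => i /=; have := h i; rewrite mulmxA -[p *m Q^T]hsubmxK.
    by rewrite mul_row_col mulmx0 addr0 row_mxKl.
  exists (rsubmx (p *m Q^T)); first by rewrite (y_eq0 (rsubmx _)).
  by rewrite hsubmxK -mulmxA QQ' mulmx1.
have all2 t : exists y, curve t = row_mx 0 y *m Q.
  have [[x xE]|//] := factor t; have := dot_curve0 t.
  by rewrite dotC y0E xE dot_cross eqxx.
have x_eq0 (x : 'rV[R]_n1) : x = 0.
  have : row_mx x 0 *m Q = 0.
    by apply: curve_total => t; have [y ->] := all2 t; rewrite dotC dot_cross.
  by move/row_eq0; rewrite -[RHS]row_mx0 => /eq_row_mx[].
(* Pulling an affine set back along [Q] turns the hull of [C2] into that of the cone, already known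
   to be everything. *)
have hull2 y : affine_hull C2 y.
  move=> A [affA C2A].
  pose A' := [set p : 'rV[R]_3 | A (rsubmx (p *m Q^T))].
  have : A' (row_mx 0 y *m Q).
    apply: affine_Kexp_full => [p q t Ap Aq|p].
      rewrite /A' /= mulmxDl -!scalemxAl linearD !linearZ /=; exact: affA.
    rewrite KE => -[x _ [y' C2y' <-]].
    by rewrite /A' /= -mulmxA QQ mulmx1 row_mxKr; exact: C2A.
  by rewrite /A' /= -mulmxA QQ mulmx1 row_mxKr.
exists c; split => //; exists (e / 4) => [|q qc]; first by rewrite divr_gt0.
rewrite KE; exists (lsubmx (q *m Q^T)); first by rewrite (x_eq0 (lsubmx _)).
exists (rsubmx (q *m Q^T)); last by rewrite hsubmxK -mulmxA QQ' mulmx1.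
apply: he; split => //.
have -> : enorm (rsubmx (q *m Q^T) - v) = enorm (q - c).
  rewrite /enorm -cE; congr Num.sqrt.
  rewrite -[in RHS](mulmx1 q) -QQ' mulmxA -mulmxBl dot_mul_orthogonal//.
  rewrite -[q *m Q^T]hsubmxK opp_row_mx add_row_mx dot_row_mx.
  by rewrite (x_eq0 (_ - u)) dot0l add0r row_mxKr.
rewrite (le_lt_trans (enorm_le _))// mulrC -ltr_pdivlMr//.
by rewrite (le_lt_trans qc)// ltr_pM2l// ltf_pV2 ?posrE// ltr_nat.
Qed.

End ProductDecomposition.

(** * Linear regularity of the faces, and reduction to facial residuals *)

Section Regularity.
Context {R : realType}.
Implicit Types n : nat.

(** Comparing arbitrary pairs instead of infima avoids nearest points. *)
Definition linearly_regular n (F V : set 'rV[R]_n) :=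
  exists2 k, 0 <= k & forall f v, F f -> V v ->
    exists w, [/\ F w, V w & `|v - w| <= k * `|f - v|].

Definition facial_residual_bound n (g : R -> R) (C V F : set 'rV[R]_n) :=
  forall M, 0 < M -> exists2 k, 0 <= k & forall p v d, C p -> V v ->
    `|p| <= M -> `|v| <= M -> 0 < d -> d <= M -> `|p - v| <= 4 * d ->
    exists2 f, F f & `|p - f| <= k * g d.

(** The constant depends on [M]: for example, [d] is bounded by a multiple of its square root only
    on bounded intervals. *)
Definition dominates (g h : R -> R) :=
  forall M, 0 < M -> exists2 k, 0 <= k &
    forall d, 0 < d -> d <= M -> h d <= k * g d.

Lemma dominates_trans (g h i : R -> R) :
  dominates g h -> dominates h i -> dominates g i.
Proof.
move=> gh hi M M0; have [k k0 hk] := gh M M0; have [l l0 hl] := hi M M0.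
exists (l * k) => [|d d0 dM]; first exact: mulr_ge0.
by rewrite (le_trans (hl d d0 dM))// -mulrA ler_wpM2l// hk.
Qed.

Lemma facial_residual_dominates n (g h : R -> R) (C V F : set 'rV[R]_n) :
  dominates g h -> facial_residual_bound h C V F -> facial_residual_bound g C V F.
Proof.
move=> gh fr M M0; have [k k0 hk] := gh M M0; have [l l0 hl] := fr M M0.
exists (l * k) => [|p v d Cp Vv pM vM d0 dM pv]; first exact: mulr_ge0.
have [f Ff pf] := hl p v d Cp Vv pM vM d0 dM pv.
by exists f => //; rewrite (le_trans pf)// -mulrA ler_wpM2l// hk.
Qed.

(** First pass from [p] to a nearby [f] in [F], then apply regularity to the pair [f], [v], whose
    distance is controlled through [p]. *)
Lemma local_error_bound_face n (g : R -> R) (C V F : set 'rV[R]_n) :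
  F `<=` C -> dominates g id -> facial_residual_bound g C V F ->
  linearly_regular F V -> local_error_bound g C V.
Proof.
move=> FC gid fr [k k0 hk] M M0.
have [l l0 hl] := fr M M0; have [i i0 hi] := gid M M0.
exists (4 * i + k * (l + 4 * i)).
  by rewrite addr_ge0 ?mulr_ge0// addr_ge0// mulr_ge0.
move=> p v d Cp Vv pM vM d0 dM pv.
have [f Ff pf] := hl p v d Cp Vv pM vM d0 dM pv.
have [w [Fw Vw vw]] := hk f v Ff Vv.
have di : d <= i * g d by exact: hi.
exists w; split => //; first exact: FC.
have -> : p - w = (p - v) + (v - w) by rewrite subrKA.
rewrite (le_trans (ler_normD _ _))// mulrDl lerD//.
  by rewrite (le_trans pv)// -mulrA ler_pM2l.
rewrite (le_trans vw)// -mulrA ler_wpM2l//.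
have -> : f - v = (p - v) - (p - f) by rewrite opprB [RHS]addrC subrKA.
rewrite (le_trans (ler_normB _ _))// addrC mulrDl lerD//.
by rewrite (le_trans pv)// -mulrA ler_pM2l.
Qed.

Definition ray n (e : 'rV[R]_n) : set 'rV[R]_n := [set t *: e | t in [set t | 0 <= t]].

(** If [e] lies in [L], the affine space contains the whole ray. Otherwise it meets the ray only at
    [c], and a functional vanishing on [L] but positive at [e] measures the distance to [c] along
    the ray. *)
Lemma ray_regular n (e : 'rV[R]_n) (L : {vspace 'rV[R]_n}) a :
  affine_space L a `&` ray e !=set0 -> linearly_regular (ray e) (affine_space L a).
Proof.
move=> [c [Vc [t0 /= t00 cE]]].
have [eL|eL] := boolP (e \in L).
  exists 1 => // f v Ff Vv; exists f; split => //.
    apply/(affine_spaceE _ Vc); rewrite -cE; case: Ff => t _ <-.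
    by rewrite -scalerBl memvZ.
  by rewrite mul1r distrC.
have [z zL ez] : exists2 z, perp [set` L] z & 0 < dot e z.
  apply: contrapT => /forall2NP h; move/negP: eL; apply.
  apply: perp_vspaceP => z zL; rewrite leNgt; apply/negP.
  by case: (h z).
exists (1 + n%:R * `|z| / dot e z * `|e|).
  by rewrite addr_ge0// mulr_ge0// divr_ge0 ?mulr_ge0// ltW.
move=> f v [t /= t0_ge fE] Vv; exists c; split=> //; first by exists t0.
have -> : v - c = (f - c) - (f - v) by rewrite opprB [RHS]addrC subrKA.
rewrite (le_trans (ler_normB _ _))// addrC mulrDl mul1r lerD2l.
have fcE : f - c = (t - t0) *: e by rewrite -fE -cE scalerBl.
have : dot (f - v) z = (t - t0) * dot e z.
  rewrite -dotZl -fcE -[f - c](subrKA v) [RHS]dotDl [dot (v - c) z]zL ?addr0//=.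
  exact/(affine_spaceE v Vc).
move=> /(congr1 Num.norm); rewrite normrM (gtr0_norm ez) => tE.
rewrite fcE normrZ mulrAC ler_wpM2r//.
rewrite mulrAC ler_pdivlMr// -tE (le_trans (dot_le _ _))//.
by rewrite mulrAC.
Qed.

(** On [L] the kernel of [z1] lies in that of [z2]: otherwise adding a kernel vector to [- l] makes
    the [z2] value equal to -1 while the [z1] value stays negative. Hence [z2] is a multiple of [z1]
    on [L]. *)
Lemma slope_bound n (L : {vspace 'rV[R]_n}) (z1 z2 : 'rV[R]_n) :
  (forall l, l \in L -> dot l z1 < 0 -> 0 <= dot l z2) ->
  exists2 k, 0 <= k & forall l, l \in L -> 0 < dot l z1 ->
    `|dot l z2| <= k * dot l z1.
Proof.
move=> h; have [[l1 l1L l1z]|no] :=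
  pselect (exists2 l, l \in L & 0 < dot l z1); last first.
  by exists 0 => // l lL lz; case: no; exists l.
exists (`|dot l1 z2| / dot l1 z1) => [|l lL lz]; first by rewrite divr_ge0// ltW.
have kill m : m \in L -> dot m z1 = 0 -> dot m z2 = 0.
  move=> mL m1; apply/eqP/negPn/negP => m2.
  have := h (- l + ((dot l z2 - 1) / dot m z2) *: m).
  rewrite memvD ?memvN ?memvZ// !dotDl !dotNl !dotZl m1 mulr0 addr0 divfK//.
  by move=> /(_ isT); rewrite oppr_lt0 => /(_ lz); lra.
have : dot (dot l1 z1 *: l - dot l z1 *: l1) z2 = 0.
  by apply: kill; rewrite ?memvB ?memvZ// dotBl !dotZl mulrC subrr.
rewrite dotBl !dotZl => /eqP; rewrite subr_eq0 => /eqP.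
move=> /(congr1 Num.norm); rewrite !normrM (gtr0_norm l1z) (gtr0_norm lz) => lE.
by rewrite mulrAC ler_pdivlMr// mulrC lE mulrC.
Qed.

(** A direction of [L] pointing strictly into the quarter-plane repairs both signs at once. Without
    one, [v] is moved towards [c] until the violated sign is repaired, and [slope_bound] controls
    the other coordinate. *)
Lemma F_minfty_regular (L : {vspace 'rV[R]_3}) a :
  affine_space L a `&` F_minfty !=set0 ->
  (forall v, affine_space L a v -> coordy v = 0) ->
  linearly_regular F_minfty (affine_space L a).
Proof.
move=> [c [Vc [cx cz cy]]] y0.
have dotx (u : 'rV[R]_3) : dot u (vec3 1 0 0) = coordx u.
  by rewrite dot3 !vec3E; ring.
have dotz (u : 'rV[R]_3) : dot u (vec3 0 0 (-1)) = - coordz u.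
  by rewrite dot3 !vec3E; ring.
have VL l v : affine_space L a v -> l \in L -> affine_space L a (v + l).
  move=> Vv lL; apply/(affine_spaceE _ Vc); rewrite addrAC memvD//.
  exact/(affine_spaceE _ Vc).
have Fv v : affine_space L a v -> coordx v <= 0 -> 0 <= coordz v -> F_minfty v.
  by move=> Vv vx vz; split => //; exact: y0.
have close (f v : 'rV[R]_3) : F_minfty f ->
    coordx v <= `|f - v| /\ - coordz v <= `|f - v|.
  move=> [fx fz _]; have := normx_le (f - v); have := normz_le (f - v).
  by rewrite !coordE !ler_norml => /andP[_ ?] /andP[? _]; split; lra.
have [[l lL [lx lz]]|no] :=
  pselect (exists2 l, l \in L & coordx l < 0 /\ 0 < coordz l).
  exists (((- coordx l)^-1 + (coordz l)^-1) * `|l|).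
    by rewrite mulr_ge0// addr_ge0// invr_ge0; lra.
  move=> f v /close -/(_ v)[vx vz] Vv.
  set r := `|f - v| in vx vz *; have r0 : 0 <= r by exact: normr_ge0.
  (* With this step each of the two coordinates gains at least [r], the largest possible
     violation. *)
  pose t := ((- coordx l)^-1 + (coordz l)^-1) * r.
  have lx0 : coordx l != 0 by rewrite lt_eqF.
  have lz0 : coordz l != 0 by rewrite gt_eqF.
  have t1 : r <= t * - coordx l.
    have -> : t * - coordx l = r + (coordz l)^-1 * - coordx l * r.
      by rewrite /t; field; rewrite lx0 lz0.
    by rewrite lerDl !mulr_ge0// ?invr_ge0; lra.
  have t2 : r <= t * coordz l.
    have -> : t * coordz l = r + (- coordx l)^-1 * coordz l * r.
      by rewrite /t; field; rewrite lx0 lz0.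
    by rewrite lerDl !mulr_ge0// ?invr_ge0; lra.
  have Vw : affine_space L a (v + t *: l) by apply: VL => //; exact: memvZ.
  exists (v + t *: l); split => //; first by apply: Fv => //; rewrite !coordE; lra.
  rewrite opprD addNKr normrN normrZ ger0_norm ?mulr_ge0//.
    by rewrite /t mulrAC.
  by rewrite addr_ge0// invr_ge0; lra.
have opp l : l \in L -> 0 < coordx l -> 0 <= coordz l.
  move=> lL lx; rewrite leNgt; apply/negP => lz; apply: no.
  by exists (- l); rewrite ?memvN// !coordE; lra.
have opp' l : l \in L -> coordz l < 0 -> coordx l <= 0.
  move=> lL lz; rewrite leNgt; apply/negP => lx; apply: no.
  by exists (- l); rewrite ?memvN// !coordE; lra.
have [|k1 k10 hk1] := @slope_bound _ L (vec3 1 0 0) (vec3 0 0 (-1)).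
  move=> l lL; rewrite dotx dotz oppr_ge0 => lx; rewrite leNgt; apply/negP => lz.
  by apply: no; exists l.
have [|k2 k20 hk2] := @slope_bound _ L (vec3 0 0 (-1)) (vec3 1 0 0).
  move=> l lL; rewrite dotx dotz oppr_lt0 => lz; rewrite leNgt; apply/negP => lx.
  by apply: no; exists l.
exists (1 + k1 + k2) => [|f v Ff Vv]; first by rewrite !addr_ge0.
have [vx vz] := close f v Ff; set r := `|f - v| in vx vz *.
have r0 : 0 <= r by exact: normr_ge0.
have lL : v - c \in L by exact/(affine_spaceE _ Vc).
have ly : coordy (v - c) = 0 by rewrite !coordE !y0//; ring.
have shrink t : affine_space L a (v - t *: (v - c)).
  by apply: VL => //; rewrite memvN memvZ.
have norml t : 0 <= t -> t * (`|coordx (v - c)| + `|coordz (v - c)|) <= (1 + k1 + k2) * r ->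
    `|v - (v - t *: (v - c))| <= (1 + k1 + k2) * r.
  move=> t_ge0; apply: le_trans; rewrite subKr normrZ ger0_norm// ler_wpM2l//.
  by apply: norm3_le; rewrite ?lerDl ?lerDr// ly normr0 addr_ge0.
have [vx0|vx0] := ltP 0 (coordx v).
  have lx : 0 < coordx (v - c) by rewrite !coordE; lra.
  have lz := opp _ lL lx.
  have := hk1 _ lL; rewrite dotx dotz normrN => /(_ lx) kl.
  (* On the way from [v] to [c], [coordx] vanishes at [t]; [coordz] only decreases towards
     [coordz c], so it stays nonnegative. *)
  pose t := coordx v / coordx (v - c).
  have t_ge0 : 0 <= t by rewrite divr_ge0// ltW.
  have t_le1 : t <= 1 by rewrite ler_pdivrMr// !coordE; lra.
  have tE : t * coordx (v - c) = coordx v by rewrite /t divfK// gt_eqF.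
  exists (v - t *: (v - c)); split => //.
    apply: Fv => //; first by rewrite coordxD coordxN coordxZ tE subrr.
    by move: lz; rewrite !coordE; nra.
  apply: norml => //; rewrite (gtr0_norm lx).
  have : t * `|coordz (v - c)| <= k1 * r.
    rewrite (le_trans (ler_wpM2l t_ge0 kl))// mulrCA tE ler_wpM2l//.
  have : 0 <= k2 * r by exact: mulr_ge0.
  by rewrite mulrDr tE; lra.
have [vz0|vz0] := ltP (coordz v) 0; last first.
  by exists v; rewrite subrr normr0 mulr_ge0 ?addr_ge0//; split => //; exact: Fv.
have lz : coordz (v - c) < 0 by rewrite !coordE; lra.
have lx := opp' _ lL lz.
have := hk2 _ lL; rewrite dotx dotz oppr_gt0 => /(_ lz) kl.
pose t := coordz v / coordz (v - c).
have t_ge0 : 0 <= t by rewrite /t -mulrNN -invrN divr_ge0//; lra.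
have tE : t * coordz (v - c) = coordz v by rewrite /t divfK// lt_eqF.
have t_le1 : t <= 1.
  by rewrite /t -mulrNN -invrN ler_pdivrMr !coordE; lra.
exists (v - t *: (v - c)); split => //.
  apply: Fv => //; last by rewrite coordzD coordzN coordzZ tE subrr.
  by move: lx; rewrite !coordE; nra.
apply: norml => //; rewrite (ltr0_norm lz).
have : t * `|coordx (v - c)| <= k2 * r.
  rewrite (le_trans (ler_wpM2l t_ge0 kl))// mulrCA mulrN tE ler_wpM2l//.
have : 0 <= k1 * r by exact: mulr_ge0.
by rewrite mulrDr mulrN tE; lra.
Qed.

End Regularity.

(** * Residual estimates for [F_minfty] and [F_beta] *)

Section FacialResiduals.
Context {R : realType}.
Implicit Types (p q : 'rV[R]_3) (s t : R).

Lemma dot_near n (V : set 'rV[R]_n) (z p v : 'rV[R]_n) d :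
  (forall v, V v -> dot v z = 0) -> V v -> `|p - v| <= 4 * d ->
  `|dot p z| <= n%:R * (4 * d) * `|z|.
Proof.
move=> Vz Vv pv; rewrite -[dot p z]subr0 -(Vz v Vv) -dotBl.
by rewrite (le_trans (dot_le _ _))// ler_wpM2r// ler_wpM2l.
Qed.

(** For [h >= -2], the square of [1 + h / 2 <= expR (h / 2)] leaves a surplus [h ^+ 2 / 4]. Below -2
    the right factor grows only linearly, and [1 + |h|] makes up for it. *)
Lemma expR_quad (h : R) : h ^+ 2 <= 4 * (1 + `|h|) * (expR h - 1 - h).
Proof.
have [h2|h2] := lerP (- 2) h.
  have e1 : 0 <= 1 + h / 2 by lra.
  have e2 : (1 + h / 2) ^+ 2 <= expR h.
    have -> : expR h = expR (h / 2) ^+ 2 by rewrite expr2 -expRD; congr expR; field.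
    by rewrite ler_sqr ?nnegrE ?expR_ge0// expR_ge1Dx.
  have := normr_ge0 h; nra.
have := expR_gt0 h; rewrite ltr0_norm; last by lra.
nra.
Qed.

(** Here [y] is at most [4 * d], and [y * expR (x / y) <= z <= M] bounds a positive [x] by
    [y * (ln M - ln y)], of order [d * (1 + |ln d|)]. *)
Lemma facial_residual_minfty (V : set 'rV[R]_3) :
  (forall v, V v -> coordy v = 0) ->
  facial_residual_bound (fun d : R => d * (1 + `|ln d|)) (@Kexp R) V (@F_minfty R).
Proof.
move=> Vy M M0; exists (4 * (1 + `|ln M| + `|ln 4|)).
  by rewrite mulr_ge0// !addr_ge0.
move=> p v d Kp Vv pM _ d0 dM pv; set k := 4 * _.
have y4d : coordy p <= 4 * d.
  rewrite -[coordy p]subr0 -(Vy v Vv) (le_trans (ler_norm _))// (le_trans _ pv)//.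
  by have := normy_le (p - v); rewrite !coordE.
have kd : 0 <= k * (d * (1 + `|ln d|)).
  by rewrite !mulr_ge0 ?addr_ge0// ltW.
case: Kp => [[y0 h]|[x0 z0 y0]]; last first.
  by exists p => //; rewrite subrr normr0.
have z0 : 0 <= coordz p by rewrite (le_trans _ h)// mulr_ge0 ?expR_ge0// ltW.
exists (vec3 (Num.min (coordx p) 0) 0 (coordz p)).
  by rewrite /F_minfty /= !vec3E ge_min lexx orbT.
have k_ge : 4 * d * (1 + `|ln M| + `|ln 4| + `|ln d|) <= k * (d * (1 + `|ln d|)).
  have -> : k * (d * (1 + `|ln d|)) =
      4 * d * ((1 + `|ln M| + `|ln 4|) * (1 + `|ln d|)) by rewrite /k; ring.
  rewrite ler_wpM2l//; first by rewrite mulr_ge0// ltW.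
  by rewrite mulrDr mulr1 lerD2l ler_peMl// -addrA lerDl addr_ge0.
apply: le_trans k_ge; apply: norm3_le; rewrite !coordE.
- have [x0|x0] := leP (coordx p) 0.
    by rewrite subrr normr0 !mulr_ge0// ?addr_ge0// ltW.
  rewrite subr0 gtr0_norm//.
  have zM : coordz p <= M by rewrite (le_trans _ pM)// (le_trans _ (normz_le p))// ler_norm.
  have xy : coordx p / coordy p <= ln M - ln (coordy p).
    rewrite -ln_div ?posrE// -ler_expR lnK ?posrE ?divr_gt0//.
    by rewrite ler_pdivlMr// mulrC (le_trans h).
  (* This is [ln t < t] at [t = 4 * d / y]; after multiplication by [y] its right side costs exactly
     [4 * d]. *)
  have lny : - ln (coordy p) <= 4 * d / coordy p - ln 4 - ln d.
    have := ln_sublinear (divr_gt0 (mulr_gt0 (ltr0Sn R 3) d0) y0).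
    rewrite ln_div ?posrE ?mulr_gt0// lnM ?posrE//; lra.
  have {}xy : coordx p <= (ln M + 4 * d / coordy p - ln 4 - ln d) * coordy p.
    by rewrite -ler_pdivrMr//; lra.
  have xE : (ln M + 4 * d / coordy p - ln 4 - ln d) * coordy p =
      4 * d + coordy p * (ln M - ln 4 - ln d) by field; rewrite gt_eqF.
  rewrite xE in xy; rewrite (le_trans xy)// -!addrA [leRHS]mulrDr mulr1 lerD2l.
  rewrite !addrA.
  have l1 : ln M - ln 4 - ln d <= `|ln M| + `|ln 4| + `|ln d|.
    have := ler_norm (ln M); have := ler_norm (- ln 4 : R); have := ler_norm (- ln d).
    by rewrite !normrN; lra.
  rewrite (le_trans (ler_wpM2l (ltW y0) l1))// ler_wpM2r// ?addr_ge0//.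
- have k1 : 1 <= 1 + `|ln M| + `|ln 4| + `|ln d|.
    by rewrite -!addrA lerDl !addr_ge0.
  by rewrite subr0 gtr0_norm// (le_trans y4d)// ler_peMr// mulr_ge0// ltW.
- by rewrite subrr normr0 !mulr_ge0// ?addr_ge0// ltW.
Qed.

(** [D] is the horizontal offset from the ray and [e], of order [d], the height above the tangent
    plane. For [y > 0], [expR_quad] at [k = D / y] bounds [D ^+ 2] by a multiple of [e]. *)
Lemma facial_residual_beta (V : set 'rV[R]_3) b :
  (forall v, V v -> dot v (tangent (1 - b)) = 0) ->
  facial_residual_bound (fun d : R => d `^ 2^-1) (@Kexp R) V (@F_beta R b).
Proof.
move=> Vt M M0; set s := 1 - b in Vt *; pose c := 3 * 4 * `|tangent s|.
have c0 : 0 <= c by rewrite mulr_ge0.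
have es := expR_gt0 s.
pose N := M + `|s| * M; pose C := 4 * (M + N) * (c / expR s).
have N0 : 0 <= N by rewrite addr_ge0 ?mulr_ge0// ltW.
have C0 : 0 <= C.
  apply: mulr_ge0; last by rewrite divr_ge0// ltW.
  by apply: mulr_ge0 => //; apply: addr_ge0 => //; exact: ltW.
exists (c * Num.sqrt M + (1 + expR s) * Num.sqrt C).
  by rewrite addr_ge0 ?mulr_ge0 ?sqrtr_ge0// addr_ge0// ltW.
move=> p v d Kp Vv pM _ d0 dM pv; rewrite powR12_sqrt 1?ltW//.
have Y0 := Kexp_y_ge0 Kp.
have YM : coordy p <= M by rewrite (le_trans (ler_norm _))// (le_trans (normy_le p)).
have XM : `|coordx p| <= M by rewrite (le_trans (normx_le p)).
pose D := coordx p - s * coordy p.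
pose e := coordz p - expR s * (D + coordy p).
have eE : e = - dot p (tangent s) by rewrite dot_tangent /e /D; ring.
have e0 : 0 <= e by rewrite eE oppr_ge0 Kexp_tangent.
have ed : e <= c * d.
  rewrite (le_trans (ler_norm _))// eE normrN.
  by rewrite (le_trans (dot_near Vt Vv pv))// le_eqVlt /c; apply/orP; left; apply/eqP; ring.
have DN : `|D| <= N.
  rewrite (le_trans (ler_normB _ _))// lerD// normrM ler_wpM2l//.
  by rewrite ger0_norm.
have D2 : D ^+ 2 <= C * d.
  have -> : C * d = 4 * (M + N) * (c * d) / expR s by rewrite /C; field; rewrite gt_eqF.
  rewrite ler_pdivlMr//.
  apply: (@le_trans _ _ (4 * (coordy p + `|D|) * e)); last first.
    rewrite ler_pM// ?mulr_ge0 ?addr_ge0//.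
    by rewrite ler_pM2l// lerD.
  case: Kp => [[y0 h]|[x0 z0 y0]]; last first.
    rewrite /e /D y0 mulr0 subr0 !addr0 add0r ler0_norm//.
    have h1 : 0 <= - coordx p * coordz p by rewrite mulr_ge0// oppr_ge0.
    have h2 : 0 <= expR s * coordx p ^+ 2 by rewrite mulr_ge0 ?sqr_ge0// ltW.
    by nra.
  pose k := D / coordy p.
  have DE : D = k * coordy p by rewrite /k divfK// gt_eqF.
  have xE : coordx p / coordy p = s + k by rewrite /k /D; field; rewrite gt_eqF.
  rewrite xE expRD in h.
  have {}h : coordy p * expR s * (expR k - 1 - k) <= e by rewrite /e DE; nra.
  have := expR_quad k; set E := expR k - 1 - k in h * => kE.
  rewrite DE normrM (gtr0_norm y0).
  have k1 : 0 <= 1 + `|k| by rewrite addr_ge0.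
  have -> : 4 * (coordy p + `|k| * coordy p) * e = 4 * coordy p * (1 + `|k|) * e by ring.
  apply: (@le_trans _ _ (4 * coordy p * (1 + `|k|) * (coordy p * expR s * E))).
    have -> : 4 * coordy p * (1 + `|k|) * (coordy p * expR s * E) =
      (coordy p ^+ 2 * expR s) * (4 * (1 + `|k|) * E) by ring.
    have -> : (k * coordy p) ^+ 2 * expR s = (coordy p ^+ 2 * expR s) * k ^+ 2 by ring.
    by rewrite ler_wpM2l// mulr_ge0 ?sqr_ge0// ltW.
  by rewrite ler_wpM2l// !mulr_ge0.
have DS : `|D| <= Num.sqrt C * Num.sqrt d.
  by rewrite -sqrtr_sqr -sqrtrM// ler_wsqrtr.
have dS : d <= Num.sqrt M * Num.sqrt d.
  rewrite -sqrtrM; last exact: ltW.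
  by rewrite -[leLHS](gtr0_norm d0) -sqrtr_sqr ler_wsqrtr// expr2 ler_wpM2r// ltW.
have sqd : 0 <= Num.sqrt d by exact: sqrtr_ge0.
exists (coordy p *: curve s); first by apply/F_betaE; exists (coordy p).
apply: (@le_trans _ _ (c * d + (1 + expR s) * `|D|)); last first.
  rewrite [leRHS]mulrDl lerD//; first by rewrite -[leRHS]mulrA ler_wpM2l.
  by rewrite -[leRHS]mulrA ler_wpM2l// addr_ge0// ltW.
have cd : 0 <= c * d by rewrite mulr_ge0// ltW.
have D_ge0 := normr_ge0 D.
have eD : 0 <= expR s * `|D| by rewrite mulr_ge0// ltW.
apply: norm3_le; rewrite !coordE.
- have -> : coordx p - coordy p * s = D by rewrite /D; ring.
  by rewrite mulrDl mul1r; lra.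
- by rewrite mulr1 subrr normr0 mulrDl mul1r; lra.
- have -> : coordz p - coordy p * expR s = e + expR s * D by rewrite /e; ring.
  rewrite (le_trans (ler_normD _ _))// normrM (gtr0_norm es) (ger0_norm e0).
  by rewrite mulrDl mul1r; lra.
Qed.

End FacialResiduals.

(** * Residual estimates for [F_infty], and growth comparisons *)

Section FacialResidualsInfty.
Context {R : realType}.
Implicit Types (p q z : 'rV[R]_3) (s t : R).

Lemma F_inftyE : @F_infty R = ray (vec3 (-1) 0 0).
Proof.
apply/seteqP; split => [p [x /= x0 <-]|p [t /= t0 <-]].
  by exists (- x); rewrite /= ?oppr_ge0//; apply: row3P; rewrite !coordE; ring.
by exists (- t); rewrite /= ?oppr_le0//; apply: row3P; rewrite !coordE; ring.
Qed.

(** The tangent inequality at 0, [x + y <= z], bounds a positive [x] by [z]. *)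
Lemma near_F_infty p : Kexp p ->
  exists2 f, F_infty f & `|p - f| <= Num.max (coordy p) (coordz p).
Proof.
move=> Kp; exists (vec3 (Num.min (coordx p) 0) 0 0).
  by exists (Num.min (coordx p) 0) => //=; rewrite ge_min lexx orbT.
have y0 := Kexp_y_ge0 Kp; have z0 := Kexp_z_ge0 Kp.
have xz : 0 < coordx p -> coordx p <= coordz p.
  move=> x0; have := Kexp_tangent 0 Kp; rewrite dot_tangent expR0; lra.
apply: norm3_le; rewrite !coordE ?subr0 ?(ger0_norm y0) ?(ger0_norm z0) ?le_max ?lexx ?orbT//.
have [x0|x0] := leP (coordx p) 0; first by rewrite subrr normr0 y0.
by rewrite subr0 gtr0_norm// xz// orbT.
Qed.

Lemma facial_residual_infty_lipschitz (V : set 'rV[R]_3) z :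
  (forall v, V v -> dot v z = 0) ->
  coordx z = 0 -> 0 < coordy z -> 0 < coordz z ->
  facial_residual_bound id (@Kexp R) V F_infty.
Proof.
move=> Vz zx zy zz M M0; pose c := 3 * 4 * `|z|.
have c0 : 0 <= c by rewrite mulr_ge0.
exists (c / coordy z + c / coordz z); first by rewrite addr_ge0// divr_ge0// ltW.
move=> p v d Kp Vv pM _ d0 dM pv.
have [f Ff pf] := near_F_infty Kp; exists f => //; apply: le_trans pf _.
have y0 := Kexp_y_ge0 Kp; have z0 := Kexp_z_ge0 Kp.
have : dot p z <= c * d.
  rewrite (le_trans (ler_norm _))// (le_trans (dot_near Vz Vv pv))//.
  by rewrite /c le_eqVlt; apply/orP; left; apply/eqP; ring.
rewrite dot3 zx mulr0 add0r => pz.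
have h1 : 0 <= coordy p * coordy z by rewrite mulr_ge0// ltW.
have h2 : 0 <= coordz p * coordz z by rewrite mulr_ge0// ltW.
have h3 : coordy p <= c / coordy z * d by rewrite mulrAC ler_pdivlMr//; lra.
have h4 : coordz p <= c / coordz z * d by rewrite mulrAC ler_pdivlMr//; lra.
by rewrite ge_max mulrDl; lra.
Qed.

(** The breakpoint of [g_minfty] and [g_infty]. *)
Definition expm2 : R := (expR 1 ^+ 2)^-1.

Lemma expm2_gt0 : 0 < expm2.
Proof. by rewrite invr_gt0 exprn_gt0// expR_gt0. Qed.

Lemma ln_expm2 : ln expm2 = - 2.
Proof. by rewrite /expm2 lnV ?posrE ?exprn_gt0 ?expR_gt0// lnXn ?expR_gt0// expRK. Qed.

Lemma ln_le_expm2 d : 0 < d -> d <= expm2 -> ln d <= - 2.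
Proof. by move=> d0 de; rewrite -ln_expm2 ler_ln ?posrE// expm2_gt0. Qed.

Lemma ln_norm_le d M : expm2 <= d -> d <= M -> `|ln d| <= 2 + `|ln M|.
Proof.
move=> ed dM; have d0 : 0 < d := lt_le_trans expm2_gt0 ed.
have l1 : - 2 <= ln d by rewrite -ln_expm2 ler_ln ?posrE// expm2_gt0.
have l2 : ln d <= ln M by rewrite ler_ln ?posrE// (lt_le_trans d0).
have := ler_norm (ln M); have := normr_ge0 (ln M).
by rewrite ler_norml => *; apply/andP; split; lra.
Qed.

Lemma g_infty_small d : 0 < d -> d <= expm2 -> g_infty d = (- ln d)^-1.
Proof. by move=> d0 de; rewrite /g_infty gt_eqF// -/expm2 de invrN. Qed.

Lemma g_infty_large d : expm2 < d -> g_infty d = 4^-1 + 4^-1 * expR 1 ^+ 2 * d.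
Proof.
move=> de; rewrite /g_infty gt_eqF ?(lt_trans expm2_gt0)// -/expm2.
by rewrite leNgt de.
Qed.

Lemma g_minfty_small d : 0 < d -> d <= expm2 -> g_minfty d = d * - ln d.
Proof. by move=> d0 de; rewrite /g_minfty gt_eqF// -/expm2 de mulNr mulrN. Qed.

Lemma g_minfty_large d : expm2 < d -> g_minfty d = d + expm2.
Proof.
move=> de; rewrite /g_minfty gt_eqF ?(lt_trans expm2_gt0)// -/expm2.
by rewrite leNgt de.
Qed.

(** Below the breakpoint this is [ln t < t] at [t = d^-1]; above it the slope is at least 1, since
    [expR 1 ^+ 2 >= 4]. *)
Lemma g_infty_dominates : dominates (@g_infty R) id.
Proof.
move=> M M0; exists 1 => // d d0 dM; rewrite mul1r.
have [de|de] := leP d expm2.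
  have ld := ln_le_expm2 d0 de; rewrite g_infty_small//.
  have l0 : 0 < - ln d by lra.
  rewrite -[leLHS]invrK lef_pV2 ?posrE ?invr_gt0// -lnV ?posrE//.
  by rewrite ltW// ln_sublinear ?invr_gt0.
have two_le : 2 <= expR 1 :> R by have := expR_ge1Dx (1 : R); lra.
rewrite g_infty_large//=.
have : 4 <= expR 1 ^+ 2 :> R by nra.
by move: (expR 1 ^+ 2) => E E4; nra.
Qed.

(** The functional bounds [z] by [c * d]. Then [x >= - M] and [x / y <= ln (c * d) - ln y] give
    [y * - ln d <= M + y * ln c - y * ln y], which is bounded. *)
Lemma facial_residual_infty_log (V : set 'rV[R]_3) z :
  (forall v, V v -> dot v z = 0) ->
  coordx z = 0 -> 0 <= coordy z -> 0 < coordz z ->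
  facial_residual_bound g_infty (@Kexp R) V F_infty.
Proof.
(* The summand 1 keeps [c] positive, so that [ln c] can be split off from [ln (c * d)]. *)
move=> Vz zx zy zz M M0; pose c := 3 * 4 * `|z| / coordz z + 1.
have c0 : 0 < c by rewrite ltr_wpDl// divr_ge0 ?mulr_ge0// ltW.
have [k k0 gk] := g_infty_dominates M0.
exists (c * k + (M * `|ln c| + M + 1) + 4 * M).
  by rewrite !addr_ge0// ?mulr_ge0// ltW.
move=> p v d Kp Vv pM _ d0 dM pv.
have [f Ff pf] := near_F_infty Kp; exists f => //; apply: le_trans pf _.
have y0 := Kexp_y_ge0 Kp; have z0 := Kexp_z_ge0 Kp.
have dg : d <= k * g_infty d by exact: gk.
have pz : coordz p <= c * d.
  have : dot p z <= 3 * (4 * d) * `|z|.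
    by rewrite (le_trans (ler_norm _))// (dot_near Vz Vv pv).
  rewrite dot3 zx mulr0 add0r => h.
  have h1 : 0 <= coordy p * coordy z by rewrite mulr_ge0.
  apply: (@le_trans _ _ (3 * 4 * `|z| / coordz z * d)).
    by rewrite mulrAC ler_pdivlMr//; lra.
  by apply: ler_wpM2r; [exact: ltW|rewrite /c lerDl].
have YM : coordy p <= M by rewrite (le_trans (ler_norm _))// (le_trans (normy_le p)).
have XM : - M <= coordx p.
  by have := le_trans (normx_le p) pM; rewrite ler_norml => /andP[].
have A0 : 0 <= M * `|ln c| + M + 1 by rewrite !addr_ge0 ?mulr_ge0// ltW.
have ck0 : 0 <= c * k by rewrite mulr_ge0// ltW.
have zg : coordz p <= c * k * g_infty d.
  by rewrite (le_trans pz)// -mulrA ler_pM2l.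
have y_le : coordy p <= (M * `|ln c| + M + 1 + 4 * M) * g_infty d.
  have [de|de] := leP d expm2; last first.
    rewrite g_infty_large//; set E := 4^-1 * _ * d.
    have E0 : 0 <= E by rewrite !mulr_ge0 ?exprn_ge0 ?expR_ge0// ltW.
    nra.
  have ld := ln_le_expm2 d0 de; rewrite g_infty_small//.
  have l0 : 0 < - ln d by lra.
  rewrite ler_pdivlMr//; apply: (@le_trans _ _ (M * `|ln c| + M + 1)); last by rewrite lerDl; lra.
  case: Kp => [[{}y0 h]|[_ _ ->]]; last by rewrite mul0r.
  have : coordx p / coordy p <= ln c + ln d - ln (coordy p).
    rewrite -lnM ?posrE// -ln_div ?posrE ?mulr_gt0// -ler_expR lnK ?posrE ?divr_gt0 ?mulr_gt0//.
    by rewrite ler_pdivlMr// mulrC (le_trans h).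
  rewrite ler_pdivrMr// => h2.
  have ly : - ln (coordy p) * coordy p <= 1.
    by rewrite -ler_pdivlMr// mul1r -lnV ?posrE// ltW// ln_sublinear ?invr_gt0.
  have lc : ln c * coordy p <= M * `|ln c|.
    rewrite (le_trans (ler_wpM2r (ltW y0) (ler_norm _)))// mulrC.
    by rewrite ler_wpM2r.
  by nra.
have g0 : 0 <= g_infty d.
  rewrite leNgt; apply/negP => g_lt; have := lt_le_trans d0 dg.
  by rewrite ltNge mulr_ge0_le0// ltW.
rewrite ge_max; apply/andP; split.
  by rewrite (le_trans y_le)// ler_wpM2r//; lra.
by rewrite (le_trans zg)// ler_wpM2r//; lra.
Qed.

Lemma g_minfty_dominates : dominates (@g_minfty R) (fun d => d * (1 + `|ln d|)).
Proof.
move=> M M0; exists (3 + `|ln M|); first by rewrite addr_ge0.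
move=> d d0 dM; have lM := normr_ge0 (ln M).
have [de|de] := leP d expm2.
  have ld := ln_le_expm2 d0 de; rewrite g_minfty_small//.
  rewrite ler0_norm; last by lra.
  have l0 : 0 <= - ln d by lra.
  by rewrite mulrCA ler_pM2l// mulrDl; have := mulr_ge0 lM l0; lra.
rewrite g_minfty_large//; have := ln_norm_le (ltW de) dM; have := expm2_gt0.
move: (ln M) (ln d) => a b *; apply: (@le_trans _ _ ((3 + `|a|) * d)).
  by rewrite mulrC; apply: ler_wpM2r; [exact: ltW|lra].
by rewrite ler_wpM2l//; lra.
Qed.

Lemma log_dominates_id : dominates (fun d : R => d * (1 + `|ln d|)) id.
Proof.
move=> M M0; exists 1 => // d d0 _; rewrite mul1r ler_peMr ?lerDl//.
exact: ltW.
Qed.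

Lemma powR_dominates_id a : 0 < a <= 1 -> dominates (fun d : R => d `^ a) id.
Proof.
move=> /andP[a0 a1] M M0; exists (M `^ (1 - a)) => [|d d0 dM]; first exact: powR_ge0.
have dE : d = d `^ (1 - a) * d `^ a.
  by rewrite -powRD ?subrK ?powRr1 ?gt_eqF// ltW.
rewrite {1}dE ler_wpM2r ?powR_ge0//.
by rewrite ge0_ler_powR ?nnegrE ?subr_ge0// ltW.
Qed.

(** With [b = 1 - a] and [u] the power of [d] with exponent [b], [ln t < t] at [u] and [u^-1] gives
    [b * |ln d| <= u + u^-1]; hence [u * (1 + |ln d|)] is bounded. *)
Lemma powR_dominates_log a : 0 < a < 1 ->
  dominates (fun d : R => d `^ a) (fun d => d * (1 + `|ln d|)).
Proof.
move=> /andP[a0 a1] M M0; pose b := 1 - a; have b0 : 0 < b by rewrite subr_gt0.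
exists (M `^ b + (M `^ b * M `^ b + 1) / b).
  apply: addr_ge0; first exact: powR_ge0.
  by apply: divr_ge0 (ltW b0); rewrite addr_ge0 ?mulr_ge0 ?powR_ge0.
move=> d d0 dM.
have dE : d = d `^ b * d `^ a.
  by rewrite -powRD /b ?subrK ?powRr1 ?gt_eqF// ltW.
have u0 : 0 < d `^ b by rewrite powR_gt0.
have uM : d `^ b <= M `^ b by rewrite ge0_ler_powR ?nnegrE// ltW.
have lnE : b * ln d = ln (d `^ b) by rewrite ln_powR.
have l1 : b * ln d <= d `^ b by rewrite lnE ltW// ln_sublinear.
have l2 : - (b * ln d) <= (d `^ b)^-1.
  by rewrite lnE -lnV ?posrE// ltW// ln_sublinear// invr_gt0.
have l3 : b * `|ln d| <= d `^ b + (d `^ b)^-1.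
  have ui : 0 < (d `^ b)^-1 by rewrite invr_gt0.
  by rewrite -[b in leLHS]gtr0_norm// -normrM ler_norml; apply/andP; split; lra.
rewrite {1}dE mulrAC ler_wpM2r ?powR_ge0// mulrDr mulr1 lerD//.
rewrite ler_pdivlMr// -mulrA [_ * b]mulrC (le_trans (ler_wpM2l (ltW u0) l3))//.
rewrite mulrDr divff ?gt_eqF// lerD2r.
by rewrite ler_pM// ltW.
Qed.

End FacialResidualsInfty.

(** * Exposing functionals and assembly of the error bounds *)

Section ErrorBounds.
Context {R : realType}.

(** [m] is the minimum of the functional over the compact unit section of [C]; homogeneity does the
    rest. *)
Lemma cone_coercive n (C : set 'rV[R]_n) (z : 'rV[R]_n) :
  closed_convex_cone C -> (forall p, C p -> p != 0 -> 0 < dot p z) ->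
  exists2 m, 0 < m & forall p, C p -> m * `|p| <= dot p z.
Proof.
move=> [_ clC _ scaleC] pos; pose S := C `&` [set p | `|p| = 1].
have scaled p : C p -> p != 0 -> S (`|p|^-1 *: p).
  move=> Cp p0; split; first by apply: scaleC; rewrite ?invr_ge0.
  by rewrite /= normrZ normfV normr_id mulVf// normr_eq0.
have [S0|S0] := pselect (S !=set0); last first.
  exists 1 => // p Cp; have [->|p0] := eqVneq p 0.
    by rewrite normr0 mulr0 dot0l.
  by case: S0; exists (`|p|^-1 *: p); exact: scaled.
have cS : compact S.
  apply: bounded_closed_compact.
    exists 1; split; first exact: num_real.
    by move=> M M1 p [_ /= ->]; exact: ltW.
  apply: closedI => //.
  have -> : [set p : 'rV[R]_n | `|p| = 1] = (fun p => `|p|) @^-1` [set 1] by [].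
  apply: preimage_closed; last exact: closed_eq.
  by move=> p _; exact: norm_continuous.
have [|c /set_mem[Cc c1] cmin] := EVT_min_rV (f := fun p => dot p z) S0 cS.
  by apply: continuous_subspaceT; exact: dot_continuous.
have c0 : c != 0 by rewrite -normr_eq0 c1 oner_eq0.
exists (dot c z) => [|p Cp]; first exact: pos.
have [->|p0] := eqVneq p 0; first by rewrite normr0 mulr0 dot0l.
have := cmin _ (mem_set (scaled p Cp p0)).
by rewrite dotZl mulrC ler_pdivlMr// normr_gt0.
Qed.

Lemma facial_residual_zero n (C V : set 'rV[R]_n) (z : 'rV[R]_n) :
  closed_convex_cone C -> dual_cone C z -> C `&` perp [set z] = [set 0] ->
  (forall v, V v -> dot v z = 0) -> facial_residual_bound id C V [set 0].
Proof.
move=> coneC Cz F0 Vz M M0.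
have [|m m0 hm] := @cone_coercive n C z coneC.
  move=> p Cp p0; rewrite lt_neqAle Cz// andbT eq_sym.
  apply: contra p0 => /eqP pz; apply/eqP.
  have : (C `&` perp [set z]) p by split => // _ ->; rewrite dotC.
  by rewrite F0.
exists (n%:R * 4 * `|z| / m); first by rewrite divr_ge0 ?mulr_ge0// ltW.
move=> p v d Cp Vv _ _ _ _ pv; exists 0 => //.
rewrite subr0 mulrAC ler_pdivlMr// mulrC (le_trans (hm p Cp))//.
rewrite (le_trans (ler_norm _))// (le_trans (dot_near Vz Vv pv))//.
by rewrite le_eqVlt; apply/orP; left; apply/eqP; ring.
Qed.

Lemma local_error_bound_dominates n (g h : R -> R) (C V : set 'rV[R]_n) :
  dominates g h -> local_error_bound h C V -> local_error_bound g C V.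
Proof.
move=> gh lb M M0; have [k k0 hk] := gh M M0; have [l l0 hl] := lb M M0.
exists (l * k) => [|p v d Cp Vv pM vM d0 dM pv]; first exact: mulr_ge0.
have [w [Cw Vw pw]] := hl p v d Cp Vv pM vM d0 dM pv.
by exists w; split => //; rewrite (le_trans pw)// -mulrA ler_wpM2l// hk.
Qed.

Lemma error_bound_face (g : R -> R) (L : {vspace 'rV[R]_3}) a F :
  affine_space L a `&` F !=set0 -> F `<=` Kexp -> 0 <= g 0 -> dominates g id ->
  facial_residual_bound g Kexp (affine_space L a) F ->
  (affine_space L a `&` F !=set0 -> linearly_regular F (affine_space L a)) ->
  error_bound g Kexp (affine_space L a).
Proof.
move=> VF FK g0 gid fr reg; have [_ clK _ _] := @Kexp_cone R.
apply: local_error_boundP => //; first exact: affine_space_closed.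
- by have [c [Vc Fc]] := VF; exists c; split => //; exact: FK.
- exact: local_error_bound_face (reg VF).
Qed.

Lemma dual_Kexp_z_ge0 (z : 'rV[R]_3) : dual_cone Kexp z -> 0 <= coordz z.
Proof.
have K3 : Kexp (vec3 0 0 1 : 'rV[R]_3) by right; rewrite /= !vec3E lexx ler01.
by move=> /(_ _ K3); rewrite dot3 !vec3E; lra.
Qed.

(** The functional vanishes at the generators of the quarter-plane; if it were zero, it would expose
    [curve 0] as well. *)
Lemma exposed_minfty (z : 'rV[R]_3) : F_minfty = Kexp `&` perp [set z] ->
  [/\ coordx z = 0, coordz z = 0 & coordy z != 0].
Proof.
move=> FE.
have : F_minfty (vec3 (- 1) 0 0 : 'rV[R]_3).
  by rewrite /F_minfty /= !vec3E lerN10.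
rewrite FE => -[_ /(_ z erefl)]; rewrite dot3 !vec3E => hx.
have : F_minfty (vec3 0 0 1 : 'rV[R]_3).
  by rewrite /F_minfty /= !vec3E ler01.
rewrite FE => -[_ /(_ z erefl)]; rewrite dot3 !vec3E => hz.
have zx : coordx z = 0 by lra.
have zz : coordz z = 0 by lra.
split => //; apply/eqP => zy.
have : F_minfty (curve 0 : 'rV[R]_3).
  rewrite FE; split; first exact: curve_Kexp.
  by move=> _ ->; rewrite dot3 zx zy zz; ring.
by move=> [_ _]; rewrite vec3y => /eqP; rewrite oner_eq0.
Qed.

(* [h * A + B (e^h - 1)] is the value of the functional along the curve, shifted
   to the point of contact; nonnegativity forces a critical point there. *)
Lemma expR_tangent_slope (A B : R) : 0 <= B ->
  (forall h, 0 <= h * A + B * (expR h - 1)) -> A = - B.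
Proof.
rewrite le_eqVlt => /predU1P[<-|B0] h.
  by have := h 1; have := h (- 1); lra.
have u0 : 0 < - A / B.
  rewrite divr_gt0// oppr_gt0 ltNge; apply/negP => A0.
  have := h (- 1); have e1 : expR (- 1) < 1 :> R by rewrite expR_lt1 ltrN10.
  nra.
set u := - A / B in u0; have AE : A = - u * B by rewrite /u; field; rewrite gt_eqF.
have := h (ln u); rewrite lnK ?posrE// AE.
have -> : ln u * (- u * B) + B * (u - 1) = B * (u - 1 - u * ln u) by ring.
rewrite pmulr_rge0// => hu.
have [l0|l0] := eqVneq (ln u) 0.
  by rewrite -[u](@lnK R) ?posrE// l0 expR0; ring.
have : 1 + - ln u < expR (- ln u) by rewrite expR_gt1Dx// oppr_eq0.
rewrite expRN lnK ?posrE// => lt1.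
have : u * (1 + - ln u) < u * u^-1 by rewrite ltr_pM2l.
by rewrite divff ?gt_eqF//; lra.
Qed.

(** Along the curve the functional attains its minimum 0 at [s], and criticality makes it a multiple
    of the tangent. A zero multiple would expose the whole cone. *)
Lemma exposed_beta b (z : 'rV[R]_3) : dual_cone Kexp z ->
  F_beta b = Kexp `&` perp [set z] ->
  exists2 k, 0 < k & forall p, dot p z = - k * dot p (tangent (1 - b)).
Proof.
move=> Kz FE; set s := 1 - b.
have : F_beta b (curve s).
  by apply/F_betaE; exists 1; rewrite ?ler01// scale1r.
rewrite FE => -[_ /(_ z erefl)]; rewrite dotC dot3 !vec3E => z0.
have zz := dual_Kexp_z_ge0 Kz.
have AE : coordx z = - (expR s * coordz z).
  apply: expR_tangent_slope => [|h]; first by rewrite mulr_ge0// expR_ge0.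
  have := Kz _ (curve_Kexp (s + h)); rewrite dot3 !vec3E expRD.
  have -> : coordy z = - s * coordx z - expR s * coordz z by lra.
  by congr (_ <= _); ring.
have zE p : dot p z = - coordz z * dot p (tangent s).
  have zy : coordy z = - s * coordx z - expR s * coordz z by lra.
  by rewrite dot_tangent dot3 zy AE; ring.
exists (coordz z) => //; rewrite lt_neqAle zz andbT eq_sym; apply/eqP => zz0.
have : F_beta b (curve (s + 1)).
  rewrite FE; split; first exact: curve_Kexp.
  by move=> _ ->; rewrite dotC zE zz0; ring.
move=> /F_betaE[y _ h].
have := congr1 (@coordx R) h; have := congr1 (@coordy R) h.
by rewrite !coordE -/s mulr1 => <-; rewrite mul1r; lra.
Qed.

Lemma exposed_infty (z : 'rV[R]_3) : dual_cone Kexp z -> F_infty = Kexp `&` perp [set z] ->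
  [/\ coordx z = 0, 0 <= coordy z & 0 < coordz z].
Proof.
move=> Kz FE.
have : F_infty (vec3 (- 1) 0 0 : 'rV[R]_3) by exists (- 1) => //=; rewrite lerN10.
rewrite FE => -[_ /(_ z erefl)]; rewrite dot3 !vec3E => hx.
have zx : coordx z = 0 by lra.
have zz : 0 < coordz z.
  rewrite lt_neqAle dual_Kexp_z_ge0// andbT eq_sym; apply/eqP => zz.
  have : F_infty (vec3 0 0 1 : 'rV[R]_3).
    rewrite FE; split; first by right; rewrite /= !vec3E lexx ler01.
    by move=> _ ->; rewrite dot3 !vec3E zz; ring.
  by move=> [x _ /(congr1 (@coordz R))]; rewrite !vec3E => /esym/eqP; rewrite oner_eq0.
split => //; rewrite leNgt; apply/negP => zy.
(* At the point of the curve with this third coordinate the functional equals half of [coordy z],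
   which would be negative. *)
have q0 : 0 < - coordy z / (2 * coordz z) by rewrite divr_gt0// ?oppr_gt0// mulr_gt0.
have := Kz _ (curve_Kexp (ln (- coordy z / (2 * coordz z)))).
rewrite dot3 !vec3E lnK ?posrE// zx.
have -> : - coordy z / (2 * coordz z) * coordz z = - coordy z / 2.
  by field; rewrite gt_eqF.
lra.
Qed.

End ErrorBounds.

Theorem theorem4p13 (R : realType) (L : {vspace 'rV[R]_3}) (a : 'rV[R]_3)
    (feas : affine_space L a `&` Kexp !=set0) :
  [/\ (d_pps Kexp L a <= 1)%E,
      d_pps Kexp L a = 0%E -> lipschitzian_error_bound Kexp (affine_space L a) &
      d_pps Kexp L a = 1%E ->
      forall F : set 'rV[R]_3,
        face_chain Kexp [:: Kexp; F] ->
        (exists2 z : 'rV[R]_3,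
           (dual_cone Kexp `&` perp [set` L] `&` perp [set a]) z &
           F = Kexp `&` perp [set z]) ->
        F `&` affine_space L a = Kexp `&` affine_space L a ->
        pps F L a ->
        [/\ F = F_minfty ->
              error_bound g_minfty (affine_space L a) Kexp /\
              (forall alpha : R, 0 < alpha < 1 ->
                 holderian_error_bound alpha Kexp (affine_space L a)),
            forall beta : R, F = F_beta beta ->
              holderian_error_bound (2^-1) Kexp (affine_space L a),
            F = F_infty ->
              let good_z := exists2 z : 'rV[R]_3,
                (dual_cone Kexp `&` perp [set` L] `&` perp [set a]) z &
                [/\ coordx z = 0, 0 < coordy z & 0 < coordz z] in
              (good_z -> lipschitzian_error_bound Kexp (affine_space L a)) /\
              (~ good_z -> error_bound g_infty (affine_space L a) Kexp) &
            F = [set 0] ->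
              lipschitzian_error_bound Kexp (affine_space L a)]].
Proof.
(* Lipschitzian bounds are phrased with the real power of exponent 1; estimates for the identity are
   transferred along this domination. *)
have id_dom : dominates (fun d : R => d `^ 1) id.
  by apply: powR_dominates_id; rewrite ltr01 lexx.
have [_ clK cvxK _] := @Kexp_cone R.
split; first exact: d_pps_Kexp_le1.
  move=> /d_pps0/pps_Kexp_interior[c [Vc [r r0 hr]]].
  apply: local_error_boundP => //.
  - exact: affine_space_closed.
  - by have [x [Vx Kx]] := feas; exists x.
  - apply: local_error_bound_dominates id_dom _.
    exact: local_error_bound_slater Vc r0 hr.
move=> _ F _ [z [[Kz zL] za] FE] FV _.
have perpV y : perp [set` L] y -> perp [set a] y ->
    forall v, affine_space L a v -> dot v y = 0.
  by move=> yL ya _ [l lL <-]; rewrite dotDl yL// ya// addr0.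
have Vz := perpV z zL za.
have FK : F `<=` Kexp by rewrite FE => p [].
have VF : affine_space L a `&` F !=set0.
  have [c [Vc Kc]] := feas; exists c; split => //.
  by have : (Kexp `&` affine_space L a) c by []; rewrite -FV => -[].
split.
- move=> FE'; rewrite FE' in FE FK VF; have [zx zz zy] := exposed_minfty FE.
  have Vy v : affine_space L a v -> coordy v = 0.
    move=> /Vz; rewrite dot3 zx zz !mulr0 add0r addr0 => /eqP.
    by rewrite mulf_eq0 (negbTE zy) orbF => /eqP.
  (* Stated for every dominating [g], this yields both the entropic bound and all Hölderian ones. *)
  have log_bound g : 0 <= g 0 -> dominates g (fun d => d * (1 + `|ln d|)) ->
      error_bound g Kexp (affine_space L a).
    move=> g0 glog; apply: (error_bound_face VF) => //.
    + exact: dominates_trans glog (@log_dominates_id R).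
    + exact: facial_residual_dominates glog (facial_residual_minfty Vy).
    + by move=> VF0; exact: F_minfty_regular.
  split=> [|alpha alpha01].
    apply/error_bound_sym/log_bound; last exact: g_minfty_dominates.
    by rewrite /g_minfty eqxx.
  by apply: log_bound; [exact: powR_ge0|exact: powR_dominates_log].
- move=> b FE'; rewrite FE' in FE FK VF; have [k k0 zE] := exposed_beta Kz FE.
  apply: (error_bound_face VF) => //.
  + by apply: powR_dominates_id; lra.
  + apply: facial_residual_beta => v /Vz/eqP; rewrite zE mulf_eq0 oppr_eq0.
    by rewrite (gt_eqF k0) => /eqP.
  + have -> : F_beta b = ray (curve (1 - b)).
      apply/seteqP; split => p; first by move=> /F_betaE[y y0 ->]; exists y.
      by move=> [y y0 <-]; apply/F_betaE; exists y.
    exact: ray_regular.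
- move=> FE'; rewrite FE' in FE FK VF; have [zx zy zz] := exposed_infty Kz FE.
  have reg : affine_space L a `&` F_infty !=set0 ->
      linearly_regular F_infty (affine_space L a).
    by rewrite F_inftyE; exact: ray_regular.
  split=> [[y [[_ yL] ya] [yx yy yz]]|_].
    apply: (error_bound_face VF) => //.
    (* The given functional [y] replaces the exposing [z]: its two positive coefficients bound both
       remaining coordinates linearly. *)
    apply: facial_residual_dominates id_dom _.
    exact: facial_residual_infty_lipschitz (perpV y yL ya) yx yy yz.
  apply/error_bound_sym/(error_bound_face VF) => //.
  + by rewrite /g_infty eqxx.
  + exact: g_infty_dominates.
  + exact: facial_residual_infty_log Vz zx zy zz.
- move=> FE'; rewrite FE' in FE FK VF; apply: (error_bound_face VF) => //.
  + apply: facial_residual_dominates id_dom _.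
    exact: facial_residual_zero (@Kexp_cone R) Kz (esym FE) Vz.
  (* The zero face is the degenerate ray, whose direction lies in every [L]. *)
  + have -> : [set 0] = ray (0 : 'rV[R]_3).
      apply/seteqP; split => [p ->|p [t _ <-]]; last by rewrite scaler0.
      by exists 0; rewrite ?scaler0 //=.
    exact: ray_regular.
Qed.
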